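(* The probability that no detectable vehicle is present within the full-scan sensing region, the disk of radius $r_{\mathrm s}>0$ centred at the origin, is $$p_{\mathrm{idle}}=\mathbb P[N(r_{\mathrm s})=0]=\exp\!\left(4\lambda_\ell\left(\int_0^{r_{\mathrm s}}e^{-\Lambda(\rho)}\,d\rho-r_{\mathrm s}\right)\right),$$ where $\Lambda(\rho)=2\int_0^{\sqrt{r_{\mathrm s}^2-\rho^2}}\lambda\,p_{\mathsf L}(\sqrt{x^2+\rho^2},H)\,dx$.
   Context: Roads: a Manhattan Poisson line process with density $\lambda_\ell>0$, i.e. horizontal lines $\{y=\rho_i\}$ and vertical lines $\{x=\rho'_j\}$, where $\{\rho_i\}$ and $\{\rho'_j\}$ are independent homogeneous Poisson point processes (PPPs) of intensity $\lambda_\ell$ on $\mathbb R$. Vehicles: conditionally on the roads, each road independently carries a homogeneous one-dimensional PPP of intensity $\lambda>0$. Blockage: with $H>0$ (UAV altitude) and $a,b>0$, $$p_{\mathsf L}(r,H)=\frac{1}{1+a\exp\!\left(-b\left[\frac{180}{\pi}\arctan(H/r)-a\right]\right)}$$ (with $\arctan(H/0)=\pi/2$). Each vehicle at horizontal distance $r$ from the origin is detectable (line-of-sight) independently with probability $p_{\mathsf L}(r,H)$. The typical UAV is above the origin, and $N(r_{\mathrm s})$ is the number of detectable vehicles in the closed disk of radius $r_{\mathrm s}$ centred at the origin. *)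

(* Defs.v *)
From HB Require Import structures.
From mathcomp Require Import all_boot all_order all_algebra.
From mathcomp Require Import all_classical all_reals all_analysis.
Import Order.TTheory GRing.Theory Num.Theory.
Import numFieldNormedType.Exports.

Set Implicit Arguments.
Unset Strict Implicit.
Unset Printing Implicit Defensive.

Local Open Scope classical_set_scope.
Local Open Scope ring_scope.

Section probability_notions.
Context {R : realType} {d : measure_display} {T : measurableType d}.
Variable P : probability T R.
Implicit Types (G : set_system T) (E : set T).

Definition independent (I : choiceType) (F : I -> set_system T) : Prop :=
  forall (s : seq I) (E : I -> set T), uniq s ->
    (forall i, i \in s -> F i (E i)) ->
    P (\bigcap_(i in [set` s]) E i) = (\prod_(i <- s) P (E i))%E.

(* f is a version of the conditional probability P(E | G). *)
Definition cond_prob G E (f : T -> R) : Prop :=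
  (forall B : set R, measurable B -> G (f @^-1` B)) /\
  (forall A, G A -> P (A `&` E) = (\int[P]_(w in A) (f w)%:E)%E).

Definition cond_independent G (I : choiceType) (F : I -> set_system T) : Prop :=
  forall (s : seq I) (E : I -> set T) (f : I -> T -> R), uniq s ->
    (forall i, i \in s -> F i (E i)) ->
    (forall i, i \in s -> cond_prob G (E i) (f i)) ->
    cond_prob G (\bigcap_(i in [set` s]) E i) (fun w => \prod_(i <- s) f i w).

Definition sigma_of_family (I : Type) (X : I -> {RV P >-> R}) : set_system T :=
  <<s [set E | exists i (B : set R), measurable B /\ E = X i @^-1` B] >>.

(* A point process on the line is given by a measurable enumeration
   X 0, X 1, ... of its points (a homogeneous Poisson process on R has almost
   surely infinitely many points). It is observed through the numbers of
   points in Borel sets, which do not depend on the enumeration. *)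
Definition npoints (X : nat -> {RV P >-> R}) (B : set R) (w : T) : \bar R :=
  counting [set k | B (X k w)].

Definition npoints_event (X : nat -> {RV P >-> R}) (B : set R) (n : nat) : set T :=
  [set w | npoints X B w = n%:R%:E].

Definition sigma_of_process (X : nat -> {RV P >-> R}) : set_system T :=
  <<s [set E | exists (B : set R) n, measurable B /\ E = npoints_event X B n] >>.

(* The library's poisson_pmf is not used since poisson_pmf 0 n = 1 for every n,
   whereas here a parameter 0 has to give the point mass at 0. *)
Definition poisson_weight (mean : R) (n : nat) : R :=
  mean ^+ n / n`!%:R * expR (- mean).

Definition bounded_disjoint_borel (m : nat) (B : 'I_m -> set R) : Prop :=
  [/\ forall j, measurable (B j), forall j, bounded_set (B j)
    & trivIset setT B].

Definition poisson_fdd (rate : R) (m : nat) (B : 'I_m -> set R)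
    (n : 'I_m -> nat) : R :=
  \prod_(j < m) poisson_weight (rate * fine (lebesgue_measure (B j))) (n j).

Definition PPP (rate : R) (X : nat -> {RV P >-> R}) : Prop :=
  forall (m : nat) (B : 'I_m -> set R) (n : 'I_m -> nat),
    bounded_disjoint_borel B ->
    P (\bigcap_j npoints_event X (B j) (n j)) = (poisson_fdd rate B n)%:E.

Definition cond_PPP G (rate : R) (X : nat -> {RV P >-> R}) : Prop :=
  forall (m : nat) (B : 'I_m -> set R) (n : 'I_m -> nat),
    bounded_disjoint_borel B ->
    cond_prob G (\bigcap_j npoints_event X (B j) (n j))
      (fun=> poisson_fdd rate B n).

End probability_notions.

(* (true, i) is the horizontal line y = rho_i and (false, j) is the vertical
   line x = rho'_j; (l, k) is the k-th vehicle of the road l. *)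
Definition road_index : choiceType := (bool * nat)%type.
Definition vehicle_index : choiceType := (road_index * nat)%type.

Section model.
Context {R : realType} {d : measure_display} {T : measurableType d}.
Variable P : probability T R.
Variable road : road_index -> {RV P >-> R}.
Variable vehicle : road_index -> nat -> {RV P >-> R}.
Variable detectable : vehicle_index -> {RV P >-> bool}.

Definition manhattan_PLP (lambda_l : R) : Prop :=
  (forall o : bool, PPP lambda_l (fun i => road (o, i))) /\
  independent P (fun o : bool => sigma_of_process (fun i => road (o, i))).

(* Conditioning is on the enumerated roads, since the vehicle processes are
   indexed by this enumeration. *)
Definition sigma_roads : set_system T := sigma_of_family road.

(* vehicle l k is the coordinate of the k-th vehicle along the road l. *)
Definition vehicles_on_roads (lambda : R) : Prop :=
  (forall l, cond_PPP sigma_roads lambda (vehicle l)) /\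
  cond_independent P sigma_roads (fun l => sigma_of_process (vehicle l)).

Definition vehicle_position (v : vehicle_index) (w : T) : R * R :=
  let: (l, k) := v in
  if l.1 then (vehicle l k w, road l w) else (road l w, vehicle l k w).

Definition horizontal_distance (v : vehicle_index) (w : T) : R :=
  Num.sqrt ((vehicle_position v w).1 ^+ 2 + (vehicle_position v w).2 ^+ 2).

Definition sigma_roads_vehicles : set_system T :=
  <<s sigma_roads `|` sigma_of_family (fun v => vehicle v.1 v.2) >>.

Definition LoS_detection (pL : R -> R) : Prop :=
  (forall v, cond_prob P sigma_roads_vehicles [set w | detectable v w]
     (fun w => pL (horizontal_distance v w))) /\
  cond_independent P sigma_roads_vehicles
    (fun v => preimage_set_system setT (detectable v) measurable).

Definition num_detectable (r : R) (w : T) : \bar R :=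
  counting [set v | detectable v w /\ horizontal_distance v w <= r].

End model.

Section formulas.
Context {R : realType}.

(* The case r = 0 is separate because H / 0 = 0 in the library. *)
Definition elevation (r H : R) : R := if r == 0 then pi / 2 else atan (H / r).

Definition p_L (a b r H : R) : R :=
  1 / (1 + a * expR (- b * (180 / pi * elevation r H - a))).

Definition Lambda (lambda a b H r_s rho : R) : R :=
  2 * \int[lebesgue_measure]_(x in `[0, Num.sqrt (r_s ^+ 2 - rho ^+ 2)])
        (lambda * p_L a b (Num.sqrt (x ^+ 2 + rho ^+ 2)) H).

End formulas.

(* Main.v *)
(* Given the roads and the vehicles, the vehicles are detected independently, so the
   idle probability is the expectation of the product over all vehicles of
   [1 - h(rho, x)], where [rho] is the coordinate of the road, [x] that of the vehicle
   along it, and [h] is the line-of-sight probability cut off at distance [r_s].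
   Given the roads, the product over the vehicles of one road has expectation
   [g rho = exp (- lambda * \int h(rho, x) dx)], the Laplace functional of a Poisson
   process; applying that functional again to the road processes and to [g] gives the
   formula, as [g rho = exp (- Lambda rho)] inside the disk and [g rho = 1] outside.

   The Laplace functional is obtained from the finite-dimensional distributions by
   rounding the values of the function.  To use it with the random function
   [h(rho, .)], the coordinate [rho] is also rounded, towards 0 because [h] is only
   continuous from that side. *)
Require Import Defs.
From mathcomp Require Import all_boot all_order all_algebra.
From mathcomp Require Import all_classical all_reals all_analysis.
From mathcomp Require Import measurable_realfun ring lra.
Import Order.TTheory GRing.Theory Num.Theory.
Import numFieldNormedType.Exports.
Local Open Scope classical_set_scope.
Local Open Scope ring_scope.

Set Implicit Arguments.
Unset Strict Implicit.
Unset Printing Implicit Defensive.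

(** * Bounded convergence, rounding, step functions and infinite products *)

Section auxiliary.
Context {R : realType}.

Lemma cvg_bigprod (I : Type) (s : seq I) (u : nat -> I -> R) (l : I -> R) :
  (forall i, u n i @[n --> \oo] --> l i) ->
  \prod_(i <- s) u n i @[n --> \oo] --> \prod_(i <- s) l i.
Proof.
move=> ul; elim: s => [|i s ih].
  under eq_fun do rewrite big_nil; rewrite big_nil; exact: cvg_cst.
under eq_fun do rewrite big_cons; rewrite big_cons.
by apply: cvgM => //; exact: ul.
Qed.

Lemma prod_itv01 (I : Type) (s : seq I) (f : I -> R) :
  (forall i, 0 <= f i <= 1) -> 0 <= \prod_(i <- s) f i <= 1.
Proof.
move=> f01; apply/andP; split.
  by apply: prodr_ge0 => i _; have /andP[] := f01 i.
by apply: prodr_ile1 => i _; exact: f01.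
Qed.

Lemma integrable01 d (T : measurableType d) (mu : {measure set T -> \bar R})
    (D : set T) (f : T -> R) :
  measurable D -> (mu D < +oo)%E -> measurable_fun D f ->
  (forall x, D x -> 0 <= f x <= 1) -> mu.-integrable D (EFin \o f).
Proof.
move=> mD Doo mf f01.
apply: (le_integrable mD (g := EFin \o cst 1)).
- exact/measurable_EFinP.
- by move=> x /f01/andP[f0 f1]; rewrite /= lee_fin normr1 ger0_norm.
- apply/integrableP; split; first exact/measurable_EFinP/measurable_cst.
  under eq_integral do rewrite /= normr1.
  by rewrite integral_cst// mul1e.
Qed.

(** Dominated convergence with the constant 1 as bound, which is integrable because [D] has finite
    measure. *)
Lemma bounded_convergence d (T : measurableType d)
    (mu : {measure set T -> \bar R}) (D : set T) (u : nat -> T -> R) (f : T -> R) :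
  measurable D -> (mu D < +oo)%E ->
  (forall n, measurable_fun D (u n)) -> measurable_fun D f ->
  {ae mu, forall x, D x -> u n x @[n --> \oo] --> f x} ->
  (forall n x, D x -> 0 <= u n x <= 1) ->
  (\int[mu]_(x in D) (u n x)%:E)%E @[n --> \oo] --> (\int[mu]_(x in D) (f x)%:E)%E.
Proof.
move=> mD Doo mu_ mf uf u01.
have [] // := @dominated_convergence _ _ _ mu D mD (fun n x => (u n x)%:E)
  (EFin \o f) (EFin \o cst 1).
- by move=> n; apply/measurable_EFinP.
- exact/measurable_EFinP.
- near=> x => Dx; apply: cvg_EFin; first by near=> n.
  by apply: (near uf x).
- by apply: integrable01 => // x _; rewrite /= ler01 lexx.
- apply: aeW => x n Dx; have /andP[u0 u1] := u01 n x Dx.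
  by rewrite lee_fin ger0_norm.
Unshelve. all: by end_near. Qed.

(** Splitting along the finitely many values of [phi] reduces the claim to each [V i]. This is how a
    rounded road coordinate is substituted into a function. *)
Lemma measurable_fun_selection d (T : measurableType d) d' (U : measurableType d')
    (N : nat) (phi : T -> 'I_N) (V : 'I_N -> T -> U) :
  (forall i, measurable (phi @^-1` [set i])) -> (forall i, measurable_fun setT (V i)) ->
  measurable_fun setT (fun w => V (phi w) w).
Proof.
move=> mphi mV _ S mS; rewrite setTI.
rewrite (_ : _ @^-1` S = \bigcup_i (phi @^-1` [set i] `&` V i @^-1` S)).
  apply: fin_bigcup_measurable => // i _; apply: measurableI => //.
  by rewrite -[X in measurable X]setTI; exact: mV.
by apply/seteqP; split => [w Sw|w [i _ [/= -> ]]//]; exists (phi w).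
Qed.

Lemma onem_itv01 (y : R) : 0 <= y <= 1 -> 0 <= 1 - y <= 1.
Proof. by move=> /andP[y0 y1]; rewrite subr_ge0 y1 lerBlDr lerDl. Qed.

Lemma ge0_integral_partition d (T : measurableType d)
    (mu : {measure set T -> \bar R}) (F : finType) (C : F -> set T) (f : T -> \bar R) :
  (forall x, measurable (C x)) -> trivIset setT C ->
  measurable_fun setT f -> (forall w, 0 <= f w)%E ->
  (\int[mu]_(w in \bigcup_x C x) f w = \sum_x \int[mu]_(w in C x) f w)%E.
Proof.
move=> mC tC mf f0.
have -> : \bigcup_x C x = \big[setU/set0]_(x <- enum F) C x.
  rewrite -bigcup_seq; congr bigcup; apply/seteqP; split => x //= _.
  by rewrite mem_enum.
rewrite ge0_integral_bigsetU//; first by rewrite big_enum.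
- exact: enum_uniq.
- exact: sub_trivIset tC.
- exact: measurable_funS mf.
Qed.

Lemma bounded_Rconvergence d (T : measurableType d)
    (mu : {measure set T -> \bar R}) (D : set T) (u : nat -> T -> R) (f : T -> R) :
  measurable D -> (mu D < +oo)%E ->
  (forall n, measurable_fun D (u n)) -> measurable_fun D f ->
  (forall x, D x -> u n x @[n --> \oo] --> f x) ->
  (forall n x, D x -> 0 <= u n x <= 1) -> (forall x, D x -> 0 <= f x <= 1) ->
  \int[mu]_(x in D) u n x @[n --> \oo] --> \int[mu]_(x in D) f x.
Proof.
move=> mD Doo mu_ mf uf u01 f01; apply: fine_cvg; rewrite fineK.
  by apply: bounded_convergence => //; exact: aeW.
by apply: integrable_fin_num => //; exact: integrable01.
Qed.

Lemma cvg_truncn (y : R) : 0 <= y ->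
  (Num.truncn (y * n.+1%:R))%:R / n.+1%:R @[n --> \oo] --> y.
Proof.
move=> y0; apply: (@squeeze_cvgr _ _ _ _ (fun n => y - n.+1%:R^-1) (cst y)).
- apply: nearW => n.
  have /andP[] := truncn_itv (mulr_ge0 y0 (ler0n R n.+1)).
  rewrite -[(Num.truncn _).+1]addn1 natrD => le1 /ltW le2.
  rewrite ler_pdivrMr ?ltr0n// le1 andbT ler_pdivlMr ?ltr0n// mulrBl mulVf ?pnatr_eq0//.
  by rewrite lerBlDr.
- rewrite -[X in _ --> X]subr0; apply: cvgB; first exact: cvg_cst.
  exact: cvg_harmonic.
- exact: cvg_cst.
Qed.

Lemma truncn_preimage (T : Type) (f : T -> R) (n : nat) : (forall x, 0 <= f x) ->
  [set x | Num.truncn (f x) = n] = f @^-1` `[n%:R, n.+1%:R[%classic.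
Proof.
move=> f0; apply/seteqP; split => x /=; rewrite in_itv/= -truncn_eq//.
  by move=> ->.
by move/eqP.
Qed.

(** When the [B i] are disjoint, this product is the step function with value [c i] on [B i] and 1
    elsewhere. With membership as an exponent, multiplying over points adds up to [c i] raised to
    the number of points in [B i]. *)
Lemma measurable_step d (T : measurableType d) (m : nat) (B : 'I_m -> set T) (c : 'I_m -> R) :
  (forall i, measurable (B i)) ->
  measurable_fun setT (fun x => \prod_i c i ^+ `[< B i x >]).
Proof.
move=> mB; apply: measurable_prod => i _.
rewrite (_ : (fun x => _) = (fun x => if x \in B i then c i else 1)); last first.
  by apply/funext => x; rewrite /in_mem/= /in_set; case: asboolP => _; rewrite ?expr1 ?expr0.
apply: measurable_fun_ifT => //.
apply: (measurable_fun_bool true); rewrite setTI.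
rewrite (_ : _ @^-1` _ = B i)//.
by apply/seteqP; split => x/= => [/set_mem|/mem_set].
Qed.

Lemma bounded_lebesgue_lty (D : set R) : measurable D -> bounded_set D ->
  (lebesgue_measure D < +oo)%E.
Proof.
move=> mD [M [_ DM]].
have DI : D `<=` `[- (M + 1), M + 1].
  by move=> x Dx; rewrite /= in_itv/= -ler_norml; apply: DM => //; rewrite ltrDl.
apply: (@le_lt_trans _ _ (lebesgue_measure `[- (M + 1), M + 1])).
  by apply: le_measure => //; rewrite inE.
by rewrite lebesgue_measure_itv/=; case: ifP => _; rewrite ?ltry// -EFinB ltry.
Qed.

Lemma lebesgue_integral_cst (D : set R) (r : R) : measurable D -> bounded_set D ->
  (\int[lebesgue_measure]_(x in D) r%:E = (r * fine (lebesgue_measure D))%:E)%E.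
Proof.
move=> mD bD; rewrite integral_cst// EFinM fineK// ge0_fin_numE//.
exact: bounded_lebesgue_lty.
Qed.

(* Junk unless the partial products converge, as they do for factors in [0, 1]. *)
Definition iprod (f : nat -> R) : R := limn (fun K => \prod_(k < K) f k).

Lemma cvg_iprod (f : nat -> R) : (forall k, 0 <= f k <= 1) ->
  \prod_(k < K) f k @[K --> \oo] --> iprod f.
Proof.
move=> f01; apply: nonincreasing_is_cvgn.
  apply/nonincreasing_seqP => n; rewrite big_ord_recr/=.
  have /andP[f0 f1] := f01 n; rewrite ler_piMr//.
  by apply: prodr_ge0 => i _; have /andP[] := f01 i.
exists 0 => _ [n _ <-]; apply: prodr_ge0 => i _; by have /andP[] := f01 i.
Qed.

Lemma iprod_itv01 (f : nat -> R) : (forall k, 0 <= f k <= 1) -> 0 <= iprod f <= 1.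
Proof.
move=> f01; have cf := cvg_iprod f01; apply/andP; split.
  apply: (limr_ge (cvgP _ cf)); apply: nearW => K.
  by have /andP[] := prod_itv01 (index_enum 'I_K) (fun k => f01 (val k)).
apply: (limr_le (cvgP _ cf)); apply: nearW => K.
by have /andP[] := prod_itv01 (index_enum 'I_K) (fun k => f01 (val k)).
Qed.

Lemma iprod_eventually1 (f : nat -> R) (K : nat) :
  (forall k, (K <= k)%N -> f k = 1) -> iprod f = \prod_(k < K) f k.
Proof.
move=> f1; apply/cvg_lim => //.
apply: cvg_near_cst; exists K => // n /= Kn.
rewrite -!(big_mkord xpredT f) (big_cat_nat (n := K))//=.
by rewrite [X in _ * X]big_nat_cond [X in _ * X]big1 ?mulr1// => k /andP[/andP[+ _] _]; exact: f1.
Qed.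

Lemma measurable_iprod d (T : measurableType d) (f : nat -> T -> R) :
  (forall k, measurable_fun setT (f k)) -> (forall k w, 0 <= f k w <= 1) ->
  measurable_fun setT (fun w => iprod (fun k => f k w)).
Proof.
move=> mf f01; apply: (@measurable_fun_cvg _ _ _ setT
    (fun K w => \prod_(k < K) f k w)) => [K|w _].
  by apply: measurable_prod => k _; exact: mf.
by apply: cvg_iprod => k; exact: f01.
Qed.

(** The cut-off [K] is common to all [n], so that every infinite product is a finite one with the
    same number of factors. *)
Lemma cvg_iprod_finite (f_ : nat -> nat -> R) (f : nat -> R) (K : nat) :
  (forall n k, (K <= k)%N -> f_ n k = 1) -> (forall k, (K <= k)%N -> f k = 1) ->
  (forall k, f_ n k @[n --> \oo] --> f k) ->
  iprod (f_ n) @[n --> \oo] --> iprod f.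
Proof.
move=> fn1 f1 ff; rewrite (iprod_eventually1 f1).
under eq_fun do rewrite (iprod_eventually1 (fn1 _)).
by apply: cvg_bigprod => k; exact: ff.
Qed.

(** The probability generating function of the Poisson law at [c], from the exponential series at
    [c * mean]. *)
Lemma cvg_exp_weight (mean c : R) :
  \sum_(n < M) c ^+ n * poisson_weight mean n @[M --> \oo] -->
  expR (- (mean * (1 - c))).
Proof.
have -> : expR (- (mean * (1 - c))) = expR (c * mean) * expR (- mean).
  by rewrite -expRD; congr expR; rewrite mulrBr mulr1 opprB mulrC.
have -> : (fun M => \sum_(n < M) c ^+ n * poisson_weight mean n) =
          (fun M => series (exp_coeff (c * mean)) M * expR (- mean)).
  apply/funext => M; rewrite /series/= big_mkord mulr_suml; apply: eq_bigr => n _.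
  by rewrite /poisson_weight /exp_coeff/= exprMn !mulrA.
by apply: cvgMl; exact: is_cvg_series_exp_coeff.
Qed.

End auxiliary.

(** * Numbers of points of an enumerated process *)

Section counts.
Context {R : realType}.

(** A finite value of [counting] forces [S] to be finite, hence bounded. The right-hand side uses
    only countable operations, which gives the measurability of counting events. *)
Lemma counting_natP (S : set nat) (n : nat) :
  counting S = n%:R%:E :> \bar R <->
  exists K, (forall k, (K <= k)%N -> ~ S k) /\ (\sum_(k < K) `[< S k >] = n)%N.
Proof.
have cnt K : (forall k, (K <= k)%N -> ~ S k) ->
    counting S = (\sum_(k < K) `[< S k >])%:R%:E :> \bar R.
  move=> SK; have fS : finite_set S.
    apply: (sub_finite_set _ (finite_II K)) => k Sk /=.
    by rewrite ltnNge; apply/negP => /SK.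
  rewrite /counting asboolT//; congr (_%:R%:E).
  rewrite -(big_mkord xpredT (fun k => nat_of_bool `[< S k >])).
  rewrite -big_mkcond sum1_count -size_filter; apply/perm_size/uniq_perm.
  - exact: finmap.fset_uniq.
  - by rewrite filter_uniq// iota_uniq.
  move=> k; rewrite mem_filter mem_index_iota/= in_fset_set//.
  case: (asboolP (S k)) => Sk; last by rewrite memNset.
  by rewrite mem_set// ltnNge; apply/esym/negP => /SK.
split=> [Sn|[K [SK <-]]]; last exact: cnt.
have fS : finite_set S.
  by apply: contrapT => fS; move: Sn; rewrite /counting asboolF.
have [K SK] : exists K, forall k, (K <= k)%N -> ~ S k.
  exists (\max_(k <- finmap.enum_fset (fset_set S)) k).+1 => k Kk Sk.
  have : (k <= \max_(i <- finmap.enum_fset (fset_set S)) i)%N.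
    by apply: (@leq_bigmax_seq _ _ xpredT id) => //; rewrite in_fset_set// mem_set.
  by rewrite leqNgt Kk.
exists K; split => //; apply/eqP; rewrite -(eqr_nat R); apply/eqP.
by apply: EFin_inj; rewrite -cnt.
Qed.

Context {d : measure_display} {T : measurableType d} (P : probability T R).
Implicit Types (X : nat -> {RV P >-> R}) (B : set R).

Lemma measurable_RV_preimage (Y : {RV P >-> R}) B :
  measurable B -> measurable (Y @^-1` B).
Proof. by move=> mB; rewrite -[_ @^-1` _]setTI; exact: measurable_funPT. Qed.

Lemma npoints_eventE X B n :
  npoints_event X B n = \bigcup_K (\bigcap_(k in [set k | (K <= k)%N]) ~` (X k @^-1` B)
    `&` [set w | (\sum_(k < K) `[< B (X k w) >] = n)%N]).
Proof.
rewrite /npoints_event; apply/seteqP; split => w.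
  by move=> /counting_natP[K [? ?]]; exists K.
by move=> [K _ [? ?]]; apply/counting_natP; exists K.
Qed.

Lemma measurable_npoints_event X B n :
  measurable B -> measurable (npoints_event X B n).
Proof.
move=> mB; rewrite npoints_eventE; apply: bigcupT_measurable => K.
apply: measurableI.
  apply: bigcap_measurable; first by exists K => /=.
  by move=> k _; exact/measurableC/measurable_RV_preimage.
have -> : [set w | (\sum_(k < K) `[< B (X k w) >] = n)%N] =
    (fun w => \sum_(k < K) \1_(X k @^-1` B) w : R) @^-1` [set n%:R].
  apply/seteqP; split => w/=.
    move=> <-; rewrite natr_sum; apply: eq_bigr => k _; rewrite indicE.
    by congr (_%:R); rewrite /in_mem/= /mem_set/=.
  have -> : \sum_(k < K) \1_(X k @^-1` B) w = (\sum_(k < K) `[< B (X k w) >])%:R :> R.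
    rewrite natr_sum; apply: eq_bigr => k _; rewrite indicE.
    by congr (_%:R); rewrite /in_mem/= /mem_set/=.
  by move=> /eqP; rewrite eqr_nat => /eqP.
rewrite -[X in measurable X]setTI; apply: (measurable_sum (D := setT)) => // k.
exact/measurable_indic/measurable_RV_preimage.
Qed.

Lemma npoints_event_uniq X B m n w :
  npoints_event X B m w -> npoints_event X B n w -> m = n.
Proof.
by rewrite /npoints_event/= => -> [] /eqP; rewrite eqr_nat => /eqP.
Qed.

(** Finitely many points lie in the sets [B i], so the product over points is finite and can be
    exchanged with the product over sets; each exponent then adds up to a count. *)
Lemma iprod_npoints X (m : nat) (B : 'I_m -> set R) (c : 'I_m -> R) (n : 'I_m -> nat) w :
  (forall i, npoints_event X (B i) (n i) w) ->
  iprod (fun k => \prod_i c i ^+ `[< B i (X k w) >]) = \prod_i c i ^+ n i.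
Proof.
move=> XBn.
have /choice[K KP] : forall i, exists K, (forall k, (K <= k)%N -> ~ B i (X k w)) /\
    (\sum_(k < K) `[< B i (X k w) >] = n i)%N.
  by move=> i; exact/counting_natP/XBn.
(* The largest bound serves all the sets [B i] at once; beyond it every exponent is 0. *)
rewrite (@iprod_eventually1 _ _ (\max_i K i)) => [|k Kk].
  rewrite exchange_big/=; apply: eq_bigr => i _; rewrite -expr_sum; congr (_ ^+ _).
  have [Ki <-] := KP i.
  rewrite -!(big_mkord xpredT (fun k => nat_of_bool `[< B i (X k w) >])).
  rewrite (big_cat_nat (n := K i))//=; last exact: leq_bigmax.
  rewrite [X in (_ + X)%N]big_nat_cond [X in (_ + X)%N]big1 ?addn0// => k.
  by move=> /andP[/andP[kK _] _]; rewrite asboolF//; exact: Ki.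
rewrite big1// => i _; rewrite asboolF ?expr0//; apply: (KP i).1.
by apply: leq_trans Kk; exact: leq_bigmax.
Qed.

End counts.

(** * Laplace functional of Poisson processes for step functions *)

Section poisson_family.
Context {R : realType} {d : measure_display} {T : measurableType d}.
Variable P : probability T R.
Implicit Types (A : set T) (rate : R).

Lemma integral_cstP A (r : R) : measurable A ->
  (\int[P]_(w in A) r%:E = r%:E * P A)%E.
Proof. by move=> mA; rewrite integral_cst. Qed.

(** Given [A], the processes are independent and Poisson. The law is multiplied by [P A] rather than
    conditioned on [A], so that null events are covered too. *)
Definition poisson_on (J : finType) A rate (X : J -> nat -> {RV P >-> R}) :=
  forall m (B : J -> 'I_m -> set R) (n : J -> 'I_m -> nat),
    (forall j, bounded_disjoint_borel (B j)) ->
    P (A `&` \bigcap_j \bigcap_i npoints_event (X j) (B j i) (n j i)) =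
    (P A * (\prod_j poisson_fdd rate (B j) (n j))%:E)%E.

Section fixed_family.
Variables (J : finType) (A : set T) (rate : R) (X : J -> nat -> {RV P >-> R}).
Hypotheses (mA : measurable A) (PX : poisson_on A rate X).

Lemma measurable_iprod_RV (Y : nat -> {RV P >-> R}) (u : R -> R) :
  measurable_fun setT u -> (forall x, 0 <= u x <= 1) ->
  measurable_fun setT (fun w => iprod (fun k => u (Y k w))).
Proof.
move=> mu u01; apply: (measurable_iprod (f := fun k w => u (Y k w))) => // k.
exact: measurableT_comp.
Qed.

Section simple.
Variables (m : nat) (B : J -> 'I_m -> set R).
Hypothesis hB : forall j, bounded_disjoint_borel (B j).

Let simple (c : J -> 'I_m -> R) j x := \prod_i c j i ^+ `[< B j i x >].
Let G c w := \prod_j iprod (fun k => simple c j (X j k w)).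
Let mean j i := rate * fine (lebesgue_measure (B j i)).
(** A cell prescribes every count. Count vectors with entries below [M] form a finite type, so that
    unions and sums over cells are finite. *)
Let cell M (n : {ffun J * 'I_m -> 'I_M}) :=
  A `&` \bigcap_j \bigcap_i npoints_event (X j) (B j i) (n (j, i)).
Let truncated M c := \prod_j \prod_i (\sum_(n < M) c j i ^+ n * poisson_weight (mean j i) n).

Let simple01 c j x : (forall j i, 0 <= c j i <= 1) -> 0 <= simple c j x <= 1.
Proof.
move=> c01; apply: prod_itv01 => i; have /andP[c0 c1] := c01 j i.
by rewrite exprn_ge0// exprn_ile1.
Qed.

Let mB j i : measurable (B j i).
Proof. by have [] := hB j. Qed.

Let measurable_simple c j : measurable_fun setT (simple c j).
Proof. by apply: measurable_step => i; exact: mB. Qed.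

Let G01 c w : (forall j i, 0 <= c j i <= 1) -> 0 <= G c w <= 1.
Proof.
by move=> c01; apply: prod_itv01 => j; apply: iprod_itv01 => k; exact: simple01.
Qed.

Let mG c : (forall j i, 0 <= c j i <= 1) -> measurable_fun setT (G c).
Proof.
move=> c01; apply: measurable_prod => j _; apply: measurable_iprod_RV; first exact: measurable_simple.
by move=> x; exact: simple01.
Qed.

Let G1 w : G (fun _ _ => 1) w = 1.
Proof.
rewrite /G big1// => j _; rewrite (@iprod_eventually1 _ _ 0) ?big_ord0// => k _.
by rewrite /simple big1// => i _; rewrite expr1n.
Qed.

Let mcell M (n : {ffun J * 'I_m -> 'I_M}) : measurable (cell n).
Proof.
apply: measurableI => //; apply: fin_bigcap_measurable => //= j _.
by apply: fin_bigcap_measurable => //= i _; exact: measurable_npoints_event.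
Qed.

(** On a cell the integrand is constant by [iprod_npoints], and [poisson_on] gives the probability
    of the cell. Distributivity turns the sum over all count vectors into the product of sums
    [truncated]. *)
Let integral_cells M c : (forall j i, 0 <= c j i <= 1) ->
  (\int[P]_(w in \bigcup_n @cell M n) (G c w)%:E = P A * (truncated M c)%:E)%E.
Proof.
move=> c01; rewrite ge0_integral_partition//; last 3 first.
- move=> n1 n2 _ _ [w [[_ w1] [_ w2]]]; apply/ffunP => -[j i]; apply/val_inj => /=.
  exact: npoints_event_uniq (w1 j I i I) (w2 j I i I).
- exact/measurable_EFinP/mG.
- by move=> w; rewrite lee_fin; have /andP[] := G01 w c01.
rewrite /truncated pair_bigA/= bigA_distr_bigA/=.
pose p := fine (P A); have pE : P A = p%:E by rewrite fineK// fin_num_measure.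
rewrite pE -EFinM mulr_sumr -sumEFin.
apply: eq_bigr => n _.
transitivity (\int[P]_(w in cell n) (\prod_j \prod_i c j i ^+ n (j, i))%:E)%E.
  apply: eq_integral => w /set_mem[_ wn]; congr EFin; apply: eq_bigr => j _.
  by apply: iprod_npoints => i; exact: wn.
have Pn : P (cell n) = (P A * (\prod_j poisson_fdd rate (B j) (fun i => n (j, i)))%:E)%E.
  exact: (PX (fun j i => n (j, i)) hB).
rewrite pE -EFinM in Pn.
rewrite integral_cstP ?mcell// Pn -EFinM.
congr EFin; rewrite mulrCA; congr (_ * _).
rewrite /poisson_fdd !pair_bigA/= -big_split/=.
by apply: eq_bigr => -[j i] _.
Qed.

(** The case where every [c j i] is 1, for which the integrand [G] is 1. *)
Let measure_cells M :
  (P (\bigcup_n @cell M n) = P A * (truncated M (fun _ _ => 1))%:E)%E.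
Proof.
rewrite -integral_cells; last by move=> *; rewrite ler01 lexx.
under eq_integral do rewrite G1.
rewrite integral_cstP ?mul1e//; apply: fin_bigcup_measurable => // n _; exact: mcell.
Qed.

Let cvg_truncated c : truncated M c @[M --> \oo] -->
  \prod_j \prod_i expR (- (mean j i * (1 - c j i))).
Proof.
apply: cvg_bigprod => j.
apply: (cvg_bigprod (u := fun M i => \sum_(n < M) c j i ^+ n * poisson_weight (mean j i) n)) => i.
exact: cvg_exp_weight.
Qed.

Let cvg_truncated1 : truncated M (fun _ _ => 1) @[M --> \oo] --> (1 : R).
Proof.
have := @cvg_truncated (fun _ _ => 1); rewrite (_ : \prod_j _ = 1)//.
by rewrite big1// => j _; rewrite big1// => i _; rewrite subrr mulr0 oppr0 expR0.
Qed.

Let mcells M : measurable (\bigcup_n @cell M n).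
Proof. by apply: fin_bigcup_measurable => // n _; exact: mcell. Qed.

Let measure_rest M : P (A `\` \bigcup_n @cell M n) =
  (fine (P A) - fine (P A) * truncated M (fun _ _ => 1))%:E.
Proof.
have pE : P A = (fine (P A))%:E by rewrite fineK// fin_num_measure.
have -> : (P (A `\` \bigcup_n @cell M n) = P A - P (A `&` \bigcup_n @cell M n))%E.
  by apply: measureD => //; rewrite (le_lt_trans (probability_le1 P mA))// ltry.
rewrite setIidr => [|w [n _ []]//].
by rewrite measure_cells pE -EFinM EFinB.
Qed.

(** As [M] grows, the Poisson weights below [M] sum to 1, so the cells exhaust [A] up to a null set.
    On a cell the counts are finite, hence only finitely many indices give a point in [B j i]. *)
Lemma ae_finitely_many_points : {ae P, forall w, A w ->
  forall j i, exists K, forall k, (K <= k)%N -> ~ B j i (X j k w)}.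
Proof.
exists (A `\` \bigcup_M \bigcup_n @cell M n); split.
- by apply: measurableD => //; apply: bigcupT_measurable => M; exact: mcells.
- apply/eqP; rewrite eq_le measure_ge0 andbT.
  have rest_le M : (P (A `\` \bigcup_M \bigcup_n @cell M n) <=
      (fine (P A) - fine (P A) * truncated M (fun _ _ => 1))%:E)%E.
    rewrite -measure_rest; apply: le_measure; rewrite ?inE.
    - by apply: measurableD => //; apply: bigcupT_measurable => k; exact: mcells.
    - by apply: measurableD => //; exact: mcells.
    - by move=> w [Aw Nw]; split => // cw; apply: Nw; exists M.
  have : (fine (P A) - fine (P A) * truncated M (fun _ _ => 1))%:E @[M --> \oo] --> 0%:E.
    apply: cvg_EFin; first exact: nearW.
    rewrite -[X in _ --> X](subrr (fine (P A) * 1)) -{1}[fine (P A)]mulr1.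
    apply: cvgB; first exact: cvg_cst.
    by apply: cvgMr; exact: cvg_truncated1.
  move=> lim0; rewrite -[leRHS]/(0%R%:E) -(cvg_lim _ lim0)//; apply: lime_ge; first exact: cvgP lim0.
  exact: nearW.
- move=> w /not_implyP[Aw nfin]; split => // -[M _ [n _ [_ cw]]]; apply: nfin => j i.
  have /counting_natP[K [BK _]] := cw j I i I.
  by exists K.
Qed.

(* The integral is computed on the event that all counts are below [M]; the rest of [A]
   has a probability that tends to 0 as [M] grows. *)
Lemma integral_iprod_simple (c : J -> 'I_m -> R) : (forall j i, 0 <= c j i <= 1) ->
  (\int[P]_(w in A) (\prod_j iprod (fun k =>
      \prod_i c j i ^+ `[< B j i (X j k w) >]))%:E =
   P A * (\prod_j \prod_i expR (- (rate * fine (lebesgue_measure (B j i)) *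
      (1 - c j i))))%:E)%E.
Proof.
move=> c01; pose p := fine (P A).
have pE : P A = p%:E by rewrite fineK// fin_num_measure.
have UA M : \bigcup_n @cell M n `<=` A by move=> w [n _ []].
have [v vE] : exists v, (\int[P]_(w in A) (G c w)%:E = v%:E)%E.
  exists (fine (\int[P]_(w in A) (G c w)%:E)); rewrite fineK//.
  apply: integrable_fin_num => //.
  apply: (le_integrable mA _ _ (finite_measure_integrable_cst P 1 mA)).
    exact/measurable_EFinP/measurable_funTS/mG.
  move=> w _ /=; have /andP[u0 u1] := G01 w c01.
  by rewrite lee_fin normr1 ger0_norm.
(* The integrand lies between 0 and 1, so outside the cells it contributes at most the probability
   of what is left of [A]. Both bounds have the same limit. *)
have bounds M : p * truncated M c <= v <= p * truncated M c + (p - p * truncated M (fun _ _ => 1)).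
  have := integral_cells M c01; rewrite pE -EFinM => cellE.
  have : (\int[P]_(w in A) (G c w)%:E = \int[P]_(w in \bigcup_n @cell M n) (G c w)%:E
      + \int[P]_(w in A `\` \bigcup_n @cell M n) (G c w)%:E)%E.
    rewrite -ge0_integral_setU//; first by rewrite setDUK.
    - exact: measurableD.
    - exact/measurable_EFinP/measurable_funTS/mG.
    - by move=> w _; rewrite lee_fin; have /andP[] := G01 w c01.
    - by apply/disj_setPRL => w [].
  have rest0 : (0 <= \int[P]_(w in A `\` \bigcup_n @cell M n) (G c w)%:E)%E.
    by apply: integral_ge0 => w _; rewrite lee_fin; have /andP[] := G01 w c01.
  have rest1 : (\int[P]_(w in A `\` \bigcup_n @cell M n) (G c w)%:E <=
      (p - p * truncated M (fun _ _ => 1))%:E)%E.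
    apply: (@le_trans _ _ (\int[P]_(w in A `\` \bigcup_n @cell M n) 1%:E)%E).
      apply: ge0_le_integral => //.
      - exact: measurableD.
      - by move=> w _; rewrite lee_fin; have /andP[] := G01 w c01.
      - exact/measurable_EFinP/measurable_funTS/mG.
      - by move=> w _; rewrite lee_fin; have /andP[] := G01 w c01.
    rewrite integral_cstP ?mul1e//; last exact: measurableD.
    by rewrite measure_rest.
  move: rest0 rest1; rewrite vE cellE.
  case: (\int[P]_(w in A `\` _) _)%E => //= t; rewrite !lee_fin => t0 t1.
  rewrite -EFinD => -[->]; by rewrite lerDl t0 lerD2l.
suff : v = p * \prod_j \prod_i expR (- (mean j i * (1 - c j i))).
  by move=> vP; rewrite vE vP pE.
have lim0 : p * truncated M c @[M --> \oo] --> p * \prod_j \prod_i expR (- (mean j i * (1 - c j i))).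
  by apply: cvgMr; exact: cvg_truncated.
have lim1 : p * truncated M c + (p - p * truncated M (fun _ _ => 1)) @[M --> \oo] -->
    p * \prod_j \prod_i expR (- (mean j i * (1 - c j i))).
  rewrite -[X in _ --> X]addr0 -[X in _ --> _ + X](subrr (p * 1)) -{2}[p]mulr1.
  apply: cvgD => //; apply: cvgB; first exact: cvg_cst.
  by apply: cvgMr; exact: cvg_truncated1.
have vlim : v @[_ --> \oo] --> p * \prod_j \prod_i expR (- (mean j i * (1 - c j i))).
  by apply: (squeeze_cvgr _ lim0 lim1); exact: nearW.
exact: (cvg_unique _ (cvg_cst v) vlim).
Qed.

End simple.
End fixed_family.
End poisson_family.

(** * Laplace functional of Poisson processes for measurable functions *)

Section laplace_functional.
Context {R : realType} {d : measure_display} {T : measurableType d}.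
Variables (P : probability T R) (J : finType) (A : set T) (rate : R).
Variable X : J -> nat -> {RV P >-> R}.
Hypotheses (mA : measurable A) (PX : poisson_on A rate X).
Variables (D : set R) (h : J -> R -> R).
Hypotheses (mD : measurable D) (bD : bounded_set D).
Hypotheses (mh : forall j, measurable_fun setT (h j)) (h01 : forall j x, 0 <= h j x <= 1).
Hypothesis h_supp : forall j x, ~ D x -> h j x = 0.

(** Since [h j x * n.+1%:R] lies between 0 and [n.+1], its truncation takes [n.+2] values, the last
    one only where [h j x = 1]. Intersecting with [D] keeps the levels bounded. *)
Let level n j (i : 'I_n.+2) : set R :=
  D `&` [set x | Num.truncn (h j x * n.+1%:R) = i].
Let approx n j x : R := (Num.truncn (h j x * n.+1%:R))%:R / n.+1%:R.

Let h0 j x : 0 <= h j x. Proof. by have /andP[] := h01 j x. Qed.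

Let hn0 n j x : 0 <= h j x * n.+1%:R.
Proof. by rewrite mulr_ge0. Qed.

Let approx_le n j x : approx n j x <= h j x.
Proof. by rewrite ler_pdivrMr ?ltr0n// truncn_le. Qed.

Let approx01 n j x : 0 <= approx n j x <= 1.
Proof.
have /andP[_ h1] := h01 j x.
by rewrite divr_ge0//= (le_trans (approx_le n j x)).
Qed.

Let level_disjoint n j : bounded_disjoint_borel (level (n := n) j).
Proof.
split.
- move=> i; apply: measurableI => //; rewrite truncn_preimage//.
  have mf : measurable_fun setT (fun x => h j x * n.+1%:R).
    by apply: measurable_funM => //; exact: mh.
  by rewrite -[X in measurable X]setTI; exact: mf.
- move=> i; by apply: sub_boundedr bD => Q QD x [Dx _]; exact: QD.
- move=> i1 i2 _ _ [x [[_ /= x1] [_ /= x2]]]; apply/val_inj => /=.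
  by rewrite -x1 -x2.
Qed.

(** A point of [D] lies in exactly one level, which contributes the only factor different from 1.
    Outside [D] there is no such factor, and [approx] vanishes along with [h]. *)
Let levelE n j x :
  \prod_(i < n.+2) (1 - i%:R / n.+1%:R) ^+ `[< level j i x >] = 1 - approx n j x.
Proof.
have [Dx|Dx] := pselect (D x); last first.
  rewrite /approx h_supp// mul0r truncn0 mul0r subr0 big1// => i _.
  by rewrite asboolF ?expr0// => -[].
have lt_n : (Num.truncn (h j x * n.+1%:R) < n.+2)%N.
  rewrite ltnS truncn_le_nat (@le_lt_trans _ _ n.+1%:R) ?ltr_nat//.
  by rewrite ler_piMl//; have /andP[] := h01 j x.
rewrite (bigD1 (Ordinal lt_n))//= asboolT ?expr1// big1 ?mulr1// => i ne.
rewrite asboolF ?expr0// => -[_ /= xi]; move/eqP: ne; apply.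
by apply/val_inj.
Qed.

Let measurable_approx n j : measurable_fun setT (approx n j).
Proof.
rewrite (_ : approx n j = fun x => 1 - (1 - approx n j x)); last first.
  by apply/funext => x; rewrite opprB addrC subrK.
under eq_fun do rewrite -levelE.
apply: measurable_funB => //; apply: measurable_step => i.
by have [] := level_disjoint n j.
Qed.

(** The left-hand side has the form of the exponent in [integral_iprod_simple] for
    [c j i = 1 - i / (n + 1)]. *)
Let integral_levels n j :
  \sum_(i < n.+2) fine (lebesgue_measure (level j i)) * (1 - (1 - i%:R / n.+1%:R)) =
  \int[lebesgue_measure]_(x in D) approx n j x.
Proof.
have D_levels : D = \bigcup_i @level n j i.
  apply/seteqP; split => [x Dx|x [i _ []]//].
  have lt_n : (Num.truncn (h j x * n.+1%:R) < n.+2)%N.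
    rewrite ltnS truncn_le_nat (@le_lt_trans _ _ n.+1%:R) ?ltr_nat//.
    by rewrite ler_piMl//; have /andP[] := h01 j x.
  by exists (Ordinal lt_n).
have [mlevel blevel tlevel] := level_disjoint n j.
rewrite /Rintegral [in RHS]D_levels ge0_integral_partition//; last 2 first.
- by apply/measurable_EFinP; exact: measurable_approx.
- by move=> x; rewrite lee_fin; have /andP[] := approx01 n j x.
have levelint (i : 'I_n.+2) : (\int[lebesgue_measure]_(x in level j i) (approx n j x)%:E =
    (fine (lebesgue_measure (level j i)) * (1 - (1 - i%:R / n.+1%:R)))%:E)%E.
  rewrite (eq_integral (cst (i%:R / n.+1%:R)%:E)); last first.
    by move=> x /set_mem[_ /= xi]; rewrite /approx xi.
  by rewrite lebesgue_integral_cst// opprB addrC subrK mulrC.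
by rewrite (eq_bigr _ (fun i _ => levelint i)) sumEFin.
Qed.

Let cvg_approx j x : approx n j x @[n --> \oo] --> h j x.
Proof. exact: cvg_truncn. Qed.

(** The step function [approx n] satisfies the identity by [integral_iprod_simple], and both sides
    pass to the limit by bounded convergence. *)
Lemma integral_iprod :
  (\int[P]_(w in A) (\prod_j iprod (fun k => 1 - h j (X j k w)))%:E =
   P A * (\prod_j expR (- (rate * \int[lebesgue_measure]_(x in D) h j x)))%:E)%E.
Proof.
have PAE : P A = (fine (P A))%:E by rewrite fineK// fin_num_measure.
have simpleE n : (\int[P]_(w in A) (\prod_j iprod (fun k => 1 - approx n j (X j k w)))%:E =
   P A * (\prod_j expR (- (rate * \int[lebesgue_measure]_(x in D) approx n j x)))%:E)%E.
  have c01 (j : J) (i : 'I_n.+2) : 0 <= 1 - (i%:R / n.+1%:R : R) <= 1.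
    apply: onem_itv01; rewrite divr_ge0//= ler_pdivrMr// mul1r ler_nat.
    by rewrite -ltnS.
  have := integral_iprod_simple mA PX (level_disjoint n) c01.
  under eq_integral => w _.
    under eq_bigr do under eq_fun do rewrite levelE.
    over.
  move=> ->; congr (_ * _%:E)%E; apply: eq_bigr => j _.
  rewrite -integral_levels mulr_sumr -sumrN expR_sum; apply: eq_bigr => i _.
  by rewrite mulrA.
have mprod (g : J -> R -> R) : (forall j, measurable_fun setT (g j)) -> (forall j x, 0 <= g j x <= 1) ->
    measurable_fun A (fun w => \prod_j iprod (fun k => 1 - g j (X j k w))).
  move=> mg g01; apply: measurable_funTS; apply: measurable_prod => j _.
  apply: (@measurable_iprod_RV _ _ _ P (X j) (fun x => 1 - g j x)).
    exact: measurable_funB.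
  by move=> x; apply: onem_itv01.
have lhs : (\int[P]_(w in A) (\prod_j iprod (fun k => 1 - approx n j (X j k w)))%:E)%E
    @[n --> \oo] -->
    (\int[P]_(w in A) (\prod_j iprod (fun k => 1 - h j (X j k w)))%:E)%E.
  apply: bounded_convergence => //.
  - by rewrite (le_lt_trans (probability_le1 P mA))// ltry.
  - by move=> n; exact: mprod.
  - exact: mprod.
  (* With [D] as a family of one set, almost surely finitely many points fall in [D]. This provides
     the common cut-off for the infinite products. *)
  - have Ddisj : forall j : J, bounded_disjoint_borel (fun _ : 'I_1 => D).
      by move=> j; split => // i1 i2 _ _ _; rewrite !ord1.
    apply: filterS (ae_finitely_many_points mA PX Ddisj) => w fin Aw.
    apply: cvg_bigprod => j; have [K DK] := fin Aw j ord0.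
    apply: (@cvg_iprod_finite _ _ _ K).
    + by move=> n k Kk; rewrite /approx h_supp ?mul0r ?truncn0 ?mul0r ?subr0//; exact: DK.
    + by move=> k Kk; rewrite h_supp ?subr0//; exact: DK.
    + by move=> k; apply: cvgB; [exact: cvg_cst|exact: cvg_approx].
  - move=> n w _; apply: prod_itv01 => j; apply: iprod_itv01 => k.
    exact: onem_itv01.
have rhs : (P A * (\prod_j expR (- (rate * \int[lebesgue_measure]_(x in D) approx n j x)))%:E)%E
    @[n --> \oo] -->
    (P A * (\prod_j expR (- (rate * \int[lebesgue_measure]_(x in D) h j x)))%:E)%E.
  rewrite PAE; apply: cvg_EFin; first exact: nearW.
  apply: cvgMr; apply: cvg_bigprod => j.
  apply: continuous_cvg; first exact: continuous_expR.
  apply: cvgN; apply: cvgMr; apply: bounded_Rconvergence => //.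
  - exact: bounded_lebesgue_lty.
  - by move=> n; apply: measurable_funTS; exact: measurable_approx.
  - by apply: measurable_funTS; exact: mh.
move: lhs; rewrite (funext simpleE) => lhs.
exact: cvg_unique lhs rhs.
Qed.

End laplace_functional.

(** * Poisson products whose function depends on a random mark *)

Section mixture.
Context {R : realType} {d : measure_display} {T : measurableType d}.

Variables (P : probability T R) (J : finType) (rate : R).
Variables (Y : J -> {RV P >-> R}) (X : J -> nat -> {RV P >-> R}).
(** This expresses that the processes are independent of the marks [Y j], tested on rectangles of
    mark values. *)
Hypothesis PX : forall C : J -> set R, (forall j, measurable (C j)) ->
  poisson_on (\bigcap_j Y j @^-1` C j) rate X.
Variable D : set R.
Hypotheses (mD : measurable D) (bD : bounded_set D).

(** The expected product of [1 - h] over the points of a Poisson process of intensity [rate], for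
    [h] supported in [D] with values in [0, 1]. *)
Definition laplace (h : R -> R) : R :=
  expR (- (rate * \int[lebesgue_measure]_(x in D) h x)).

Hypothesis rate0 : 0 <= rate.

Lemma laplace_itv01 (h : R -> R) : (forall x, 0 <= h x) -> 0 <= laplace h <= 1.
Proof.
move=> h0; rewrite expR_ge0/= -[leRHS]expR0 ler_expR oppr_le0 mulr_ge0//.
by apply: Rintegral_ge0 => x _; exact: h0.
Qed.

(** The space is split by the tuple of values [phi (Y j)], of which there are finitely many. On each
    piece [C f] the functions are deterministic, and [integral_iprod] applies with [C f] as the
    event. *)
Lemma integral_iprod_selection (N : nat) (phi : R -> 'I_N) (h : 'I_N -> R -> R) :
  (forall i, measurable (phi @^-1` [set i])) ->
  (forall i, measurable_fun setT (h i)) -> (forall i x, 0 <= h i x <= 1) ->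
  (forall i x, ~ D x -> h i x = 0) ->
  (\int[P]_w (\prod_j iprod (fun k => 1 - h (phi (Y j w)) (X j k w)))%:E =
   \int[P]_w (\prod_j laplace (h (phi (Y j w))))%:E)%E.
Proof.
move=> mphi mh h01 h_supp.
pose C (f : {ffun J -> 'I_N}) := \bigcap_j Y j @^-1` (phi @^-1` [set f j]).
have mphiY j i : measurable ((phi \o Y j) @^-1` [set i]).
  exact: (measurable_RV_preimage (Y j) (mphi i)).
have mC f : measurable (C f).
  by apply: fin_bigcap_measurable => // j _; exact: mphiY.
have CT : [set: T] = \bigcup_f C f.
  by apply/seteqP; split => // w _; exists [ffun j => phi (Y j w)] => // j _ /=; rewrite ffunE.
have tC : trivIset setT C.
  move=> f1 f2 _ _ [w [w1 w2]]; apply/ffunP => j.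
  by rewrite -(w1 j I) -(w2 j I).
rewrite CT !ge0_integral_partition//; last 4 first.
- apply/measurable_EFinP; apply: measurable_prod => j _.
  exact: (measurable_fun_selection (phi := phi \o Y j) (V := fun i _ => laplace (h i))).
- move=> w; rewrite lee_fin; have /andP[] //:= prod_itv01 (index_enum J)
    (fun j => laplace_itv01 (fun x => proj1 (andP (h01 (phi (Y j w)) x)))).
- apply/measurable_EFinP; apply: measurable_prod => j _.
  apply: (measurable_iprod (f := fun k w => 1 - h (phi (Y j w)) (X j k w))) => [k|k w].
    apply: (measurable_fun_selection (phi := phi \o Y j) (V := fun i w => 1 - h i (X j k w))) => // i.
    by apply: measurable_funB => //; exact: measurableT_comp.
  exact: onem_itv01.
- move=> w; rewrite lee_fin.
  have /andP[] // := prod_itv01 (index_enum J) (fun j => iprod_itv01 (fun k =>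
    onem_itv01 (h01 (phi (Y j w)) (X j k w)))).
apply: eq_bigr => f _.
have Cf w : w \in C f -> forall j, phi (Y j w) = f j.
  by move=> /set_mem Cw j; exact: Cw.
transitivity (\int[P]_(w in C f) (\prod_j iprod (fun k => 1 - h (f j) (X j k w)))%:E)%E.
  by apply: eq_integral => w /Cf wf; under eq_bigr do rewrite wf.
transitivity (\int[P]_(w in C f) (\prod_j laplace (h (f j)))%:E)%E; last first.
  by apply: eq_integral => w /Cf wf; under [in RHS]eq_bigr do rewrite wf.
have PC : poisson_on (C f) rate X by apply: PX => j; exact: mphi.
rewrite (integral_iprod (mC f) PC mD bD (h := fun j => h (f j)))//.
  by rewrite integral_cstP// muleC.
by move=> j x; exact: h_supp.
Qed.

Variables (h : R -> R -> R) (N : nat -> nat).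
(** [phi n] rounds a mark to one of finitely many classes, and [tau] gives the representative of a
    class. *)
Variables (phi : forall n, R -> 'I_(N n)) (tau : forall n, 'I_(N n) -> R).
Hypotheses (mh : forall rho, measurable_fun setT (h rho))
  (h01 : forall rho x, 0 <= h rho x <= 1) (h_supp : forall rho x, ~ D x -> h rho x = 0).
Hypotheses (mphi : forall n i, measurable (phi n @^-1` [set i]))
  (h_approx : forall rho x, h (tau (phi n rho)) x @[n --> \oo] --> h rho x).

Let cvg_laplace rho : laplace (h (tau (phi n rho))) @[n --> \oo] --> laplace (h rho).
Proof.
apply: continuous_cvg; first exact: continuous_expR.
apply: cvgN; apply: cvgMr; apply: bounded_Rconvergence => //.
- exact: bounded_lebesgue_lty.
- by move=> n; apply: measurable_funTS; exact: mh.
- by apply: measurable_funTS; exact: mh.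
Qed.

Let laplaceh01 rho : 0 <= laplace (h rho) <= 1.
Proof. by apply: laplace_itv01 => x; have /andP[] := h01 rho x. Qed.

(** The hypotheses give measurability of [h] in [x] for each fixed [rho]; measurability in [rho]
    comes from the limit of functions of the finite-valued [phi n]. *)
Lemma measurable_laplace : measurable_fun setT (fun rho => laplace (h rho)).
Proof.
apply: (@measurable_fun_cvg _ _ _ setT (fun n rho => laplace (h (tau (phi n rho))))) => //.
by move=> n; exact: (measurable_fun_selection (phi := phi n) (V := fun i _ => laplace (h (tau i)))).
Qed.

(** The identity holds for rounded marks by [integral_iprod_selection]; bounded convergence removes
    the rounding on both sides. *)
Lemma integral_iprod_mixture :
  (\int[P]_w (\prod_j iprod (fun k => 1 - h (Y j w) (X j k w)))%:E =
   \int[P]_w (\prod_j laplace (h (Y j w)))%:E)%E.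
Proof.
have PTlty : (P setT < +oo)%E by rewrite probability_setT ltry.
have mphiY n j i : measurable ((phi n \o Y j) @^-1` [set i]).
  by have := measurable_RV_preimage (Y j) (@mphi n i).
have mfactor n j k : measurable_fun setT (fun w => 1 - h (tau (phi n (Y j w))) (X j k w)).
  apply: (measurable_fun_selection (phi := phi n \o Y j)
    (V := fun i w => 1 - h (tau i) (X j k w))) => // i.
  by apply: measurable_funB => //; exact: measurableT_comp.
have cvg_factor j k w : 1 - h (tau (phi n (Y j w))) (X j k w) @[n --> \oo] -->
    1 - h (Y j w) (X j k w).
  by apply: cvgB; [exact: cvg_cst|exact: h_approx].
have lhs : (\int[P]_w (\prod_j iprod (fun k => 1 - h (tau (phi n (Y j w))) (X j k w)))%:E)%E
    @[n --> \oo] --> (\int[P]_w (\prod_j iprod (fun k => 1 - h (Y j w) (X j k w)))%:E)%E.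
  apply: bounded_convergence => //.
  - move=> n; apply: measurable_prod => j _.
    by apply: measurable_iprod => // k w; exact: onem_itv01.
  - apply: measurable_prod => j _; apply: measurable_iprod => [k|k w]; last exact: onem_itv01.
    exact: (@measurable_fun_cvg _ _ _ setT
      (fun n w => 1 - h (tau (phi n (Y j w))) (X j k w))).
  (* Taking every [C j] to be the whole line yields the law without restriction on the marks, hence
     almost surely finitely many points in [D]. *)
  - have PT : poisson_on setT rate X.
      have := PX (fun j : J => @measurableT _ R).
      by rewrite (_ : \bigcap_j _ = setT)//; apply/seteqP; split.
    have Ddisj : forall j : J, bounded_disjoint_borel (fun _ : 'I_1 => D).
      by move=> j; split => // i1 i2 _ _ _; rewrite !ord1.
    apply: filterS (ae_finitely_many_points measurableT PT Ddisj) => w fin Aw.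
    apply: cvg_bigprod => j; have [K DK] := fin Aw j ord0.
    apply: (@cvg_iprod_finite _ _ _ K).
    + by move=> n k Kk; rewrite h_supp ?subr0//; exact: DK.
    + by move=> k Kk; rewrite h_supp ?subr0//; exact: DK.
    + by move=> k; exact: cvg_factor.
  - move=> n w _; apply: prod_itv01 => j; apply: iprod_itv01 => k.
    exact: onem_itv01.
have rhs : (\int[P]_w (\prod_j laplace (h (tau (phi n (Y j w)))))%:E)%E
    @[n --> \oo] --> (\int[P]_w (\prod_j laplace (h (Y j w)))%:E)%E.
  apply: bounded_convergence => //.
  - move=> n; apply: measurable_prod => j _.
    exact: (measurable_fun_selection (phi := phi n \o Y j) (V := fun i _ => laplace (h (tau i)))).
  - apply: measurable_prod => j _.
    exact: (measurableT_comp measurable_laplace).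
  - by apply: aeW => w _; apply: cvg_bigprod => j; exact: cvg_laplace.
  - by move=> n w _; apply: prod_itv01 => j; exact: laplaceh01.
have simpleE n : (\int[P]_w (\prod_j iprod (fun k => 1 - h (tau (phi n (Y j w))) (X j k w)))%:E =
    \int[P]_w (\prod_j laplace (h (tau (phi n (Y j w)))))%:E)%E.
  apply: (integral_iprod_selection (phi := phi n) (h := fun i => h (tau i))) => //.
  by move=> i x; exact: h_supp.
move: lhs; rewrite (funext simpleE) => lhs.
exact: cvg_unique lhs rhs.
Qed.

End mixture.

(** * Independence over finite index types and conditional probabilities *)

Section independence.
Context {R : realType} {d : measure_display} {T : measurableType d}.
Variable P : probability T R.

Lemma pick_inj (J : finType) (I : choiceType) (e : J -> I) (U : Type) (x0 : U) (g : J -> U) j :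
  injective e -> (if [pick j' | e j' == e j] is Some j' then g j' else x0) = g j.
Proof.
move=> inj_e; case: pickP => [j' /eqP/inj_e -> //|/(_ j)].
by rewrite eqxx.
Qed.

(** Transfers conditional independence from duplicate-free lists in [I] to a finite type: the family
    on [J] is carried to [I] by inverting the injection [e]. *)
Lemma cond_independent_fin (G : set_system T) (I : choiceType) (F : I -> set_system T)
    (J : finType) (S : {set J}) (e : J -> I) (E : J -> set T) (f : J -> T -> R) :
  cond_independent P G F -> injective e -> (forall j, F (e j) (E j)) ->
  (forall j, cond_prob P G (E j) (f j)) ->
  cond_prob P G (\bigcap_(j in [set` S]) E j) (fun w => \prod_(j in S) f j w).
Proof.
move=> indep inj_e FE Ef.
(* The values off the image of [e] are arbitrary defaults: the list considered contains only indices
   of the form [e j]. *)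
pose E' i := if [pick j | e j == i] is Some j then E j else setT.
pose f' i := if [pick j | e j == i] is Some j then f j else cst 0.
have E'e j : E' (e j) = E j by exact: pick_inj.
have f'e j : f' (e j) = f j by exact: pick_inj.
have := indep [seq e j | j <- enum S] E' f'.
rewrite map_inj_uniq// enum_uniq => /(_ isT).
have -> : \bigcap_(i in [set` [seq e j | j <- enum S]]) E' i = \bigcap_(j in [set` S]) E j.
  apply/seteqP; split => w wE.
    move=> j /= jS; rewrite -E'e; apply: wE => /=.
    by apply: map_f; rewrite mem_enum.
  move=> i /= /mapP[j]; rewrite mem_enum => jS ->; rewrite E'e; exact: wE.
rewrite (_ : (fun w => _) = (fun w => \prod_(j in S) f j w)); last first.
  apply/funext => w; rewrite big_map big_enum; apply: eq_bigr => j _.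
  by rewrite f'e.
by apply => i /mapP[j _ ->]; rewrite ?E'e ?f'e.
Qed.

Lemma independent_fin (I : choiceType) (F : I -> set_system T)
    (J : finType) (e : J -> I) (E : J -> set T) :
  independent P F -> injective e -> (forall j, F (e j) (E j)) ->
  P (\bigcap_j E j) = (\prod_j P (E j))%E.
Proof.
move=> indep inj_e FE.
pose E' i := if [pick j | e j == i] is Some j then E j else setT.
have E'e j : E' (e j) = E j by exact: pick_inj.
have := indep [seq e j | j <- enum J] E'.
rewrite map_inj_uniq// enum_uniq => /(_ isT).
have -> : \bigcap_(i in [set` [seq e j | j <- enum J]]) E' i = \bigcap_j E j.
  apply/seteqP; split => w wE.
    move=> j /= _; rewrite -E'e; apply: wE => /=.
    by apply: map_f; rewrite mem_enum.
  by move=> i /= /mapP[j _ ->]; rewrite E'e; exact: wE.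
move=> ->; last by move=> i /mapP[j _ ->]; rewrite E'e.
by rewrite big_map big_enum; apply: eq_bigr => j _; rewrite E'e.
Qed.

Lemma sigma_of_process_fdd (X : nat -> {RV P >-> R}) m (B : 'I_m -> set R) (n : 'I_m -> nat) :
  (forall i, measurable (B i)) ->
  sigma_of_process X (\bigcap_i npoints_event X (B i) (n i)).
Proof.
move=> mB.
apply: (@fin_bigcap_measurable _ (g_sigma_algebraType
  [set E | exists (B : set R) n, measurable B /\ E = npoints_event X B n])) => // i _.
by apply: sub_sigma_algebra; exists (B i), (n i).
Qed.

Lemma sigma_of_family_preimage (I : Type) (Y : I -> {RV P >-> R}) i (B : set R) :
  measurable B -> sigma_of_family Y (Y i @^-1` B).
Proof. by move=> mB; apply: sub_sigma_algebra; exists i, B. Qed.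

Lemma sigma_of_family_measurable (I : Type) (Y : I -> {RV P >-> R}) :
  sigma_of_family Y `<=` measurable.
Proof.
apply: smallest_sub; first exact: sigma_algebra_measurable.
by move=> _ [i [B [mB ->]]]; exact: measurable_RV_preimage.
Qed.

Lemma cond_prob_complement (G : set_system T) (E : set T) (f : T -> R) :
  G `<=` measurable -> measurable E -> (forall w, 0 <= f w <= 1) ->
  cond_prob P G E f -> cond_prob P G (~` E) (fun w => 1 - f w).
Proof.
move=> Gm mE f01 [Gf Pf]; split => [B mB|A GA].
  apply: (Gf ((fun y => 1 - y) @^-1` B)).
  have mB1 : measurable_fun setT (fun y : R => 1 - y) by exact: measurable_funB.
  by rewrite -[X in measurable X]setTI; exact: mB1.
have mA := Gm _ GA.
have mf : measurable_fun setT f by move=> _ B mB; rewrite setTI; exact/Gm/Gf.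
have Alty : (P A < +oo)%E by rewrite (le_lt_trans (probability_le1 P mA))// ltry.
have int_f : P.-integrable A (EFin \o f).
  by apply: integrable01 => //; exact: measurable_funTS.
under eq_integral do rewrite EFinB.
rewrite integralB_EFin//; last first.
  by apply: (integrable01 (f := cst 1)) => // w _; rewrite /= ler01 lexx.
rewrite -Pf// (integral_cstP P 1 mA) mul1e -setDE.
by apply: measureD.
Qed.

End independence.

(** * Poisson laws and detection in the road model *)

Section poisson_model.
Context {R : realType} {d : measure_display} {T : measurableType d}.
Variables (P : probability T R) (road : road_index -> {RV P >-> R}).
Variable vehicle : road_index -> nat -> {RV P >-> R}.

(** The conditional law of the counts given the roads has a constant version, so integrating it over
    an event of the roads just multiplies by the probability of that event. *)
Lemma poisson_on_vehicles (lambda : R) (J : finType) (e : J -> road_index) (C : J -> set R) :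
  vehicles_on_roads road vehicle lambda -> injective e -> (forall j, measurable (C j)) ->
  poisson_on (\bigcap_j road (e j) @^-1` C j) lambda (fun j => vehicle (e j)).
Proof.
move=> [fdd indep] inj_e mC m B n hB.
have roads_C : sigma_roads road (\bigcap_j road (e j) @^-1` C j).
  apply: (@fin_bigcap_measurable _ (g_sigma_algebraType
    [set E | exists l (B : set R), measurable B /\ E = road l @^-1` B])) => // j _.
  exact: sigma_of_family_preimage.
have sE j : sigma_of_process (vehicle (e j))
    (\bigcap_i npoints_event (vehicle (e j)) (B j i) (n j i)).
  by apply: sigma_of_process_fdd; have [] := hB j.
have [_ cE] := cond_independent_fin [set: J]%SET indep inj_e sE
  (fun j => fdd (e j) m (B j) (n j) (hB j)).
have := cE _ roads_C.
rewrite integral_cstP; last exact: (sigma_of_family_measurable roads_C).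
rewrite muleC (eq_bigl xpredT) => [<-|j]; last by rewrite inE.
congr (P (_ `&` _)); apply/seteqP; split => w wE j _; apply: wE => //.
by rewrite /= inE.
Qed.

Lemma poisson_on_roads (lambda_l : R) :
  manhattan_PLP road lambda_l ->
  poisson_on setT lambda_l (fun o i => road (o, i)).
Proof.
move=> [fdd indep] m B n hB; rewrite setTI probability_setT mul1e.
rewrite (independent_fin indep (e := id))//; last first.
  by move=> o; apply: sigma_of_process_fdd; have [] := hB o.
by rewrite (eq_bigr _ (fun o _ => fdd o m (B o) (n o) (hB o))) prodEFin.
Qed.

Section detection.
Variables (detectable : vehicle_index -> {RV P >-> bool}) (pL : R -> R) (r : R).
Hypothesis LoS : LoS_detection road vehicle detectable pL.
Hypothesis pL01 : forall x, 0 <= pL x <= 1.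

Let hd v w := horizontal_distance road vehicle v w.
Let G := sigma_roads road `|` sigma_of_family (fun v : vehicle_index => vehicle v.1 v.2).

Let measurable_sigma : sigma_roads_vehicles road vehicle `<=` measurable.
Proof.
apply: smallest_sub; first exact: sigma_algebra_measurable.
by move=> E [] /sigma_of_family_measurable.
Qed.

(** Measurability is with respect to the sigma-algebra of roads and vehicles, so that events about
    distances may be conditioned on. *)
Lemma measurable_horizontal_distance v :
  measurable_fun [set: g_sigma_algebraType G] (hd v).
Proof.
have mroad l : measurable_fun [set: g_sigma_algebraType G] (road l).
  move=> _ B mB; rewrite setTI; apply: sub_sigma_algebra; left.
  exact: sigma_of_family_preimage.
have mvehicle l k : measurable_fun [set: g_sigma_algebraType G] (vehicle l k).
  move=> _ B mB; rewrite setTI; apply: sub_sigma_algebra; right.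
  exact: (@sigma_of_family_preimage _ _ _ P _ (fun v : vehicle_index => vehicle v.1 v.2) (l, k)  B mB).
have msum : measurable_fun [set: g_sigma_algebraType G] (fun w =>
    (vehicle_position road vehicle v w).1 ^+ 2 + (vehicle_position road vehicle v w).2 ^+ 2).
  case: v => -[[] i] k /=;
    by apply: measurable_funD; exact: measurable_funX.
exact: (measurableT_comp (continuous_measurable_fun (@sqrt_continuous R)) msum).
Qed.

Lemma measurable_undetectable v : measurable (~` [set w | detectable v w]).
Proof.
apply: measurableC; rewrite (_ : [set w | _] = detectable v @^-1` [set true])//.
by rewrite -[X in measurable X]setTI; exact: measurable_funPT.
Qed.

Let mhd v : measurable_fun setT (hd v).
Proof.
move=> _ B mB; rewrite setTI; apply: measurable_sigma.
by have := measurable_horizontal_distance v measurableT mB; rewrite setTI.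
Qed.

Lemma measurable_undetected v : measurable (~` [set w | detectable v w /\ hd v w <= r]).
Proof.
rewrite setCI; apply: measurableU; first exact: measurable_undetectable.
apply: measurableC; have : measurable (setT `&` hd v @^-1` `]-oo, r]) by exact: mhd.
by rewrite setTI; congr measurable; apply/seteqP; split => w; rewrite /= in_itv.
Qed.

(** The space is split by the set [S] of those vehicles that lie in the disk. The piece [C S]
    belongs to the conditioning sigma-algebra, and on it the event says that the vehicles of [S] are
    all undetected, to which conditional independence applies. *)
Lemma prob_no_detectable (J : finType) (e : J -> vehicle_index) : injective e ->
  (P (\bigcap_j ~` [set w | detectable (e j) w /\ (hd (e j) w <= r)%R]) =
   \int[P]_w (\prod_j (1 - (if (hd (e j) w <= r)%R then pL (hd (e j) w) else 0)))%:E)%E.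
Proof.
move=> inj_e; have [cond indep] := LoS.
set E := \bigcap_j _.
pose C (S : {set J}) := \bigcap_j [set w | (hd (e j) w <= r) = (j \in S)].
have GC S : sigma_roads_vehicles road vehicle (C S).
  apply: (@fin_bigcap_measurable _ (g_sigma_algebraType G)) => // j _.
  have mle : measurable_fun [set: g_sigma_algebraType G] (fun w => hd (e j) w <= r).
    by apply: measurable_fun_ler => //; exact: measurable_horizontal_distance.
  by have := mle measurableT [set (j \in S)] I; rewrite setTI.
have mC S : measurable (C S) by exact: (measurable_sigma (GC S)).
have tC : trivIset setT C.
  move=> S1 S2 _ _ [w [w1 w2]]; apply/setP => j.
  by rewrite -(w1 j I) -(w2 j I).
have CT : [set: T] = \bigcup_S C S.
  apply/seteqP; split => // w _; exists [set j | hd (e j) w <= r]%SET => // j _ /=.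
  by rewrite inE.
(* Measurability of this composite is part of [cond_prob]. *)
have mpL v : measurable_fun setT (fun w => pL (hd v w)).
  by move=> _ B mB; rewrite setTI; apply: measurable_sigma; exact: (cond v).1.
have mE : measurable E.
  by apply: fin_bigcap_measurable => // j _; exact: measurable_undetected.
have factor01 j w : 0 <= 1 - (if hd (e j) w <= r then pL (hd (e j) w) else 0) <= 1.
  by case: ifP => _; [exact: onem_itv01|rewrite subr0 ler01 lexx].
have -> : (P E = \int[P]_w (\1_E w)%:E)%E by rewrite integral_indic// setIT.
rewrite CT !ge0_integral_partition//; last 3 first.
- apply/measurable_EFinP; apply: measurable_prod => j _; apply: measurable_funB => //.
  apply: measurable_fun_ifT => //.
  by apply: measurable_fun_ler => //; exact: mhd.
- by move=> w; rewrite lee_fin; have /andP[] := prod_itv01 (index_enum J) (factor01^~ w).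
- exact/measurable_EFinP/measurable_indic.
apply: eq_bigr => S _; rewrite integral_indic//.
have undet j : preimage_set_system setT (detectable (e j)) measurable
    (~` [set w | detectable (e j) w]).
  by exists [set~ true] => //; rewrite setTI; apply/seteqP; split => w.
have cond_undet j : cond_prob P (sigma_roads_vehicles road vehicle)
    (~` [set w | detectable (e j) w]) (fun w => 1 - pL (hd (e j) w)).
  apply: cond_prob_complement => //.
  by rewrite -[[set w | _]]setCK; apply: measurableC; exact: measurable_undetectable.
have [_ condS] := cond_independent_fin S indep inj_e undet cond_undet.
transitivity (P (C S `&` \bigcap_(j in [set` S]) ~` [set w | detectable (e j) w])).
  rewrite setIC; congr (P _); apply/seteqP; split => w [Cw Ew]; split => // j.
    move=> /= jS; have := Ew j I; rewrite /= => h det; apply: h; split => //.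
    by rewrite (Cw j I).
  move=> _ [det]; rewrite (Cw j I) => jS; exact: (Ew j jS).
rewrite (condS _ (GC S)); apply: eq_integral => w /set_mem Cw; congr EFin.
rewrite [RHS](bigID (mem S))/= [X in _ = _ * X]big1 ?mulr1 => [|j jS].
  by apply: eq_bigr => j jS; rewrite (Cw j I) jS.
by rewrite (Cw j I) (negbTE jS) subr0.
Qed.

End detection.
End poisson_model.

(** * The line-of-sight probability, its cut-off and its rounding *)

Section blockage.
Context {R : realType}.
Variables (a b H r : R).
Hypotheses (a0 : 0 < a) (H0 : 0 < H) (r0 : 0 < r).

(** The right-hand side lies in the range of [atan], and its tangent is the inverse of
    [tan (atan x)]. *)
Lemma atan_inv (x : R) : 0 < x -> atan x^-1 = pi / 2 - atan x.
Proof.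
move=> x0; have pi0 := pi_gt0 R.
have at0 : 0 < atan x by rewrite -(atan0 R) lt_atan.
have at1 := atan_ltpi2 x.
have c0 : cos (atan x) != 0 by rewrite cos_atan invr_neq0// sqrtr_eq0 -ltNge ltr_wpDr// ?sqr_ge0.
rewrite -[RHS]tanK; last by rewrite in_itv/=; apply/andP; split; lra.
congr atan; rewrite /tan sinB cosB sin_pihalf cos_pihalf !mul0r !mul1r subr0 add0r.
by rewrite -[in LHS](atanK x) /tan invf_div.
Qed.

(* The second form of the elevation angle is continuous at distance [0]. *)
Definition p_L_cont (s : R) : R :=
  1 / (1 + a * expR (- b * (180 / pi * (pi / 2 - atan (s / H)) - a))).

Lemma p_L_contE s : 0 <= s -> p_L a b s H = p_L_cont s.
Proof.
move=> s0; rewrite /p_L /p_L_cont /elevation; have [->|s_neq0] := eqVneq s 0.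
  by rewrite mul0r atan0 subr0.
by rewrite -atan_inv ?invf_div// divr_gt0// lt_neqAle eq_sym s_neq0.
Qed.

Lemma p_L_itv01 s : 0 <= p_L a b s H <= 1.
Proof.
have e0 : 0 <= a * expR (- b * (180 / pi * elevation s H - a)).
  by rewrite mulr_ge0 ?expR_ge0// ltW.
by rewrite /p_L divr_ge0 ?addr_ge0//= ler_pdivrMr ?ltr_wpDr// mul1r lerDl.
Qed.

Lemma continuous_p_L_cont : continuous p_L_cont.
Proof.
move=> s; apply: cvgM; first exact: cvg_cst.
apply: cvgV.
  by rewrite gt_eqF// ltr_wpDr// mulr_ge0 ?expR_ge0// ltW.
apply: cvgD; first exact: cvg_cst.
apply: cvgMr; apply: continuous_cvg; first exact: continuous_expR.
apply: cvgMr; apply: cvgB; last exact: cvg_cst.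
apply: cvgMr; apply: cvgB; first exact: cvg_cst.
apply: continuous_cvg; first exact: continuous_atan.
by apply: cvgMl; exact: cvg_id.
Qed.

(** It depends on its arguments only through the sum of their squares, and so serves horizontal and
    vertical roads alike. *)
Definition detection_prob (rho x : R) : R :=
  if Num.sqrt (rho ^+ 2 + x ^+ 2) <= r then p_L a b (Num.sqrt (rho ^+ 2 + x ^+ 2)) H else 0.

Lemma detection_prob_itv01 rho x : 0 <= detection_prob rho x <= 1.
Proof.
by rewrite /detection_prob; case: ifP => _; [exact: p_L_itv01|rewrite lexx ler01].
Qed.

Lemma detection_prob_abs rho x : detection_prob `|rho| x = detection_prob rho x.
Proof. by rewrite /detection_prob real_normK// num_real. Qed.

Lemma detection_probN rho x : detection_prob rho (- x) = detection_prob rho x.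
Proof. by rewrite /detection_prob sqrrN. Qed.

Lemma detection_prob0l rho x : r < `|rho| -> detection_prob rho x = 0.
Proof.
move=> rrho; rewrite /detection_prob ifF//; apply/negbTE; rewrite -ltNge.
apply: (lt_le_trans rrho); rewrite -sqrtr_sqr ler_wsqrtr// lerDl sqr_ge0//.
Qed.

Lemma detection_prob0r rho x : ~ `[- r, r]%classic x -> detection_prob rho x = 0.
Proof.
rewrite /= in_itv/= -ler_norml => /negP; rewrite -ltNge => rx.
by rewrite /detection_prob addrC -/(detection_prob x rho) detection_prob0l.
Qed.

Lemma measurable_detection_prob d (T : measurableType d) (Y X : T -> R) :
  measurable_fun setT Y -> measurable_fun setT X ->
  measurable_fun setT (fun w => detection_prob (Y w) (X w)).
Proof.
move=> mY mX.
have mdist : measurable_fun setT (fun w => Num.sqrt (Y w ^+ 2 + X w ^+ 2)).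
  apply: (measurableT_comp (continuous_measurable_fun (@sqrt_continuous R))).
  by apply: measurable_funD; exact: measurable_funX.
rewrite (_ : (fun w => _) = fun w => if Num.sqrt (Y w ^+ 2 + X w ^+ 2) <= r
    then p_L_cont (Num.sqrt (Y w ^+ 2 + X w ^+ 2)) else 0); last first.
  by apply/funext => w; rewrite /detection_prob p_L_contE// sqrtr_ge0.
apply: measurable_fun_ifT => //; first exact: measurable_fun_ler.
exact: (measurableT_comp (continuous_measurable_fun continuous_p_L_cont)).
Qed.

(* [|rho|] is rounded down to a multiple of [1 / (n + 1)], and capped beyond [r], where
   [detection_prob] vanishes, so as to take finitely many values. *)
Definition round_cap n := ((Num.truncn r).+1 * n.+1)%N.
Definition round_index n (rho : R) : 'I_(round_cap n).+1 :=
  inord (minn (Num.truncn (`|rho| * n.+1%:R)) (round_cap n)).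
Definition round_value n (i : 'I_(round_cap n).+1) : R := i%:R / n.+1%:R.

Let round_indexE n rho :
  round_index n rho = minn (Num.truncn (`|rho| * n.+1%:R)) (round_cap n) :> nat.
Proof. by rewrite inordK// ltnS geq_minr. Qed.

Lemma measurable_round_index n i : measurable (round_index n @^-1` [set i]).
Proof.
rewrite (_ : _ @^-1` _ = \bigcup_(k in [set k | minn k (round_cap n) = i])
    [set rho | Num.truncn (`|rho| * n.+1%:R) = k]); last first.
  apply/seteqP; split => rho /=.
    by move=> <-; exists (Num.truncn (`|rho| * n.+1%:R)) => //=; rewrite round_indexE.
  by move=> [k /= ki rk]; apply/val_inj; rewrite /= round_indexE rk.
apply: bigcup_measurable => k _; rewrite truncn_preimage => [|x]; last by rewrite mulr_ge0.
have mf : measurable_fun setT (fun rho : R => `|rho| * n.+1%:R).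
  by apply: measurable_funM => //; exact: measurableT_comp.
by rewrite -[X in measurable X]setTI; exact: mf.
Qed.

(** Rounding towards 0 never increases the distance. A point of the closed disk thus stays inside,
    where continuity applies; a point strictly outside is eventually rounded to a point outside. *)
Lemma cvg_detection_prob_round rho x :
  detection_prob (round_value (round_index n rho)) x @[n --> \oo] --> detection_prob rho x.
Proof.
pose c : R := (Num.truncn r).+1%:R.
have rc : r < c by exact: truncnS_gt.
(* The rounded values converge to this capped coordinate. As [c] exceeds [r], capping does not
   change [detection_prob]. *)
pose rho' := Num.min `|rho| c.
have rho'0 : 0 <= rho' by rewrite le_min normr_ge0 ler0n.
have -> : detection_prob rho x = detection_prob rho' x.
  rewrite /rho' /Num.min; case: ifPn => [_|]; first by rewrite detection_prob_abs.
  rewrite -leNgt => crho; rewrite !detection_prob0l//; first by rewrite ger0_norm// ler0n.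
  exact: lt_le_trans crho.
pose t n := round_value (round_index n rho).
have tE n : t n = Num.min ((Num.truncn (`|rho| * n.+1%:R))%:R / n.+1%:R) c.
  rewrite /t /round_value round_indexE; case: leqP => [le_cap|/ltnW lt_cap].
    by apply/esym/min_idPl; rewrite ler_pdivrMr ?ltr0n// -natrM ler_nat.
  rewrite natrM mulfK ?pnatr_eq0//; apply/esym/min_idPr.
  by rewrite ler_pdivlMr ?ltr0n// -natrM ler_nat.
have t_le n : t n <= rho'.
  rewrite le_min tE !ge_min lexx orbT andbT ler_pdivrMr ?ltr0n//.
  by rewrite truncn_le mulr_ge0.
have t0 n : 0 <= t n by rewrite /t /round_value divr_ge0.
have cvg_t : t n @[n --> \oo] --> rho'.
  (* Written with an absolute value, the minimum is a continuous expression to which the limit rules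
     apply. *)
  rewrite (funext tE); under eq_fun do rewrite minr_absE.
  rewrite /rho' minr_absE; have ct := cvg_truncn (normr_ge0 rho).
  apply: cvgMl; apply: cvgB; first by apply: cvgD => //; exact: cvg_cst.
  by apply: cvg_norm; apply: cvgB => //; exact: cvg_cst.
pose dist y : R := Num.sqrt (y ^+ 2 + x ^+ 2).
have dist_le n : dist (t n) <= dist rho'.
  by rewrite ler_wsqrtr// lerD2r ler_sqr ?nnegrE//; exact: t_le.
have cvg_dist : dist (t n) @[n --> \oo] --> dist rho'.
  have cvg_sum : t n ^+ 2 + x ^+ 2 @[n --> \oo] --> rho' ^+ 2 + x ^+ 2.
    by apply: cvgD; [exact: cvgM|exact: cvg_cst].
  exact: (cvg_comp _ _ cvg_sum (@sqrt_continuous R _)).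
rewrite /detection_prob -/(dist rho'); case: ifPn => [le_r|]; last first.
  rewrite -ltNge => lt_r; apply: cvg_near_cst; near=> n.
  rewrite ifF//; apply/negbTE; rewrite -ltNge -/(t n) -/(dist (t n)).
  by near: n; exact: cvgr_gt cvg_dist _ lt_r.
rewrite p_L_contE ?sqrtr_ge0//.
have -> : (fun n => if dist (t n) <= r then p_L a b (dist (t n)) H else 0) =
    (fun n => p_L_cont (dist (t n))).
  by apply/funext => n; rewrite (le_trans (dist_le n) le_r) p_L_contE ?sqrtr_ge0.
by apply: continuous_cvg => //; exact: continuous_p_L_cont.
Unshelve. all: by end_near. Qed.

End blockage.

(** * From integrals over the line to the closed formula *)

Section formula.
Context {R : realType}.

Lemma integrable_itv01 (f : R -> R) (i : interval R) : bounded_set [set` i] ->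
  measurable_fun setT f -> (forall x, 0 <= f x <= 1) ->
  lebesgue_measure.-integrable [set` i] (EFin \o f).
Proof.
move=> bi mf f01; apply: integrable01 => //; last exact: measurable_funTS.
by apply: bounded_lebesgue_lty.
Qed.

Lemma bounded_set_itvcc (x y : R) : bounded_set (`[x, y]%classic : set R).
Proof.
exists (Num.max `|x| `|y|); split; first by rewrite num_real.
move=> M xyM z /=; rewrite in_itv/= => /andP[xz zy].
apply: le_trans (ltW xyM); rewrite ler_norml.
have := ler_norm y; have := ler_norm (- x); rewrite normrN => hx hy.
by rewrite lerNl !le_max (le_trans _ hx) ?lerN2// (le_trans zy hy) orbT.
Qed.

(** The interval is split at 0, and the negative half is reflected using the invariance of Lebesgue
    measure under negation. *)
Lemma Rintegral_even (f : R -> R) (s : R) : 0 <= s ->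
  measurable_fun setT f -> (forall x, 0 <= f x <= 1) -> (forall x, f (- x) = f x) ->
  \int[lebesgue_measure]_(x in `[- s, s]) f x = 2 * \int[lebesgue_measure]_(x in `[0, s]) f x.
Proof.
move=> s0 mf f01 fN.
have intf (i : interval R) : bounded_set [set` i] -> lebesgue_measure.-integrable [set` i] (EFin \o f).
  by move=> bi; exact: (integrable_itv01 bi mf f01).
have split_itv : `[- s, s]%classic = `[- s, 0[%classic `|` `[0, s]%classic :> set R.
  by rewrite -itv_bndbnd_setU// bnd_simp// oppr_le0.
have bco : bounded_set (`[- s, 0[%classic : set R).
  apply: sub_boundedr (bounded_set_itvcc (- s) 0) => Q Qs x /=.
  by rewrite in_itv/= => /andP[sx /ltW x0]; apply: Qs; rewrite /= in_itv/= sx.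
rewrite split_itv Rintegral_setU//; last 2 first.
- by rewrite -split_itv; apply: intf; exact: bounded_set_itvcc.
- apply/disj_setPRL => x /=; rewrite !in_itv/= => /andP[x0 _]; apply/negP.
  by rewrite negb_and -leNgt x0 orbT.
rewrite Rintegral_itv_bndo_bndc; last exact: intf.
suff -> : \int[lebesgue_measure]_(x in `[- s, 0]) f x = \int[lebesgue_measure]_(x in `[0, s]) f x.
  by rewrite mulr_natl mulr2n.
congr fine.
transitivity (\int[pushforward lebesgue_measure (-%R : _ -> measurableTypeR R)]_(x in `[(- s)%R, 0%R]) (f x)%:E)%E.
  by apply: eq_measure_integral => B mB _; exact/esym/lebesgue_measureN.
rewrite ge0_integral_pushforward//=; last 2 first.
- by apply/measurable_EFinP; exact: measurable_funTS.
- by move=> x _; rewrite lee_fin; have /andP[] := f01 x.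
rewrite opp_preimage_itvbndbnd/= oppr0 opprK.
by apply: eq_integral => x _; rewrite /= fN.
Qed.

Lemma Rintegral_one_itv (s : R) : 0 < s ->
  \int[lebesgue_measure]_(x in `[0, s]) (1 : R) = s.
Proof.
move=> s0; rewrite /Rintegral lebesgue_integral_cst//; last exact: bounded_set_itvcc.
by rewrite mul1r lebesgue_measure_itv/= lte_fin s0 oppr0 adde0.
Qed.

Variables (a b H r : R).
Hypotheses (a0 : 0 < a) (H0 : 0 < H) (r0 : 0 < r).

(** The road at distance [rho] meets the disk in a chord of half-length [s]. Evenness in [x] gives
    the factor 2 of [Lambda], and the cut-off at distance [r] becomes the bound [s] of its
    integral. *)
Lemma laplace_detection_prob (lambda rho : R) : 0 <= rho <= r ->
  laplace lambda `[- r, r] (detection_prob a b H r rho) = expR (- Lambda lambda a b H r rho).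
Proof.
move=> /andP[rho0 rho_r]; rewrite /laplace; congr (expR (- _)).
have md : measurable_fun setT (detection_prob a b H r rho).
  by apply: (measurable_detection_prob b r a0 H0 (Y := cst rho) (X := id)).
rewrite Rintegral_even//; last 3 first.
- exact: ltW.
- by move=> x; exact: detection_prob_itv01.
- by move=> x; exact: detection_probN.
rewrite mulrCA /Lambda -RintegralZl//; last first.
  by apply: integrable_itv01 => //; [exact: bounded_set_itvcc|move=> x; exact: detection_prob_itv01].
congr (_ * _); set s := Num.sqrt _.
have sub0 : 0 <= r ^+ 2 - rho ^+ 2.
  by rewrite subr_ge0 ler_sqr ?nnegrE// (le_trans rho0).
have s_r : s <= r.
  rewrite -(ger0_norm (ltW r0)) -sqrtr_sqr ler_wsqrtr// gerBl; exact: sqr_ge0.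
have s0 : 0 <= s by exact: sqrtr_ge0.
(* Both integrals are brought to the domain from 0 to [r], so that the integrands can be compared
   pointwise. *)
have -> : `[0, s]%classic = `[0, r]%classic `&` `[0, s]%classic.
  apply/esym/setIidr => x /=; rewrite !in_itv/= => /andP[-> xs] /=.
  exact: le_trans s_r.
rewrite Rintegral_mkcondr; apply: eq_Rintegral => x /set_mem /=.
rewrite in_itv/= => /andP[x0 _]; rewrite patchE mem_setE in_itv/= x0/=.
rewrite /detection_prob [rho ^+ 2 + _]addrC.
have -> : (Num.sqrt (x ^+ 2 + rho ^+ 2) <= r) = (x <= s).
  rewrite -[in RHS](ger0_norm x0) -[in RHS]sqrtr_sqr ler_sqrt//.
  rewrite -[in LHS](ger0_norm (ltW r0)) -[in LHS](sqrtr_sqr r) ler_sqrt ?sqr_ge0//.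
  by rewrite lerBrDr.
by case: ifP => _; rewrite ?mulr0.
Qed.

(** The factor 4 is the product of 2 for the two directions of roads and 2 for evenness in [rho]. *)
Lemma idle_exponent (lambda lambda_l : R) :
  measurable_fun setT (fun rho => laplace lambda `[- r, r] (detection_prob a b H r rho)) ->
  0 <= lambda ->
  \prod_(o : bool) expR (- (lambda_l * \int[lebesgue_measure]_(rho in `[- r, r])
    (1 - laplace lambda `[- r, r] (detection_prob a b H r rho)))) =
  expR (4 * lambda_l * (\int[lebesgue_measure]_(rho in `[0, r])
    expR (- Lambda lambda a b H r rho) - r)).
Proof.
move=> mg lambda0; pose g rho := laplace lambda `[- r, r] (detection_prob a b H r rho).
have g01 rho : 0 <= g rho <= 1.
  by apply: laplace_itv01 => // x; have /andP[] := detection_prob_itv01 b H r a0 rho x.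
have gE : \int[lebesgue_measure]_(rho in `[0, r]) expR (- Lambda lambda a b H r rho) =
    \int[lebesgue_measure]_(rho in `[0, r]) g rho.
  apply: eq_Rintegral => rho /set_mem; rewrite /= in_itv/= => rho0r.
  by rewrite /g laplace_detection_prob.
have bi : bounded_set (`[0, r]%classic : set R) by exact: bounded_set_itvcc.
have even : \int[lebesgue_measure]_(rho in `[- r, r]) (1 - g rho) =
    2 * \int[lebesgue_measure]_(rho in `[0, r]) (1 - g rho).
  apply: Rintegral_even; first exact: ltW.
  - exact: measurable_funB.
  - by move=> x; exact: onem_itv01.
  - move=> rho; congr (1 - laplace _ _ _); apply/funext => x.
    by rewrite -detection_prob_abs normrN detection_prob_abs.
have intB : \int[lebesgue_measure]_(rho in `[0, r]) (1 - g rho) =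
    r - \int[lebesgue_measure]_(rho in `[0, r]) g rho.
  have int1 := integrable_itv01 bi (measurable_cst (1 : R)) (fun=> introT andP (conj ler01 (lexx 1))).
  have intg := integrable_itv01 bi mg g01.
  transitivity (\int[lebesgue_measure]_(rho in `[0, r]) (1 : R) -
      \int[lebesgue_measure]_(rho in `[0, r]) g rho).
    exact: (RintegralB (mu := lebesgue_measure) (measurable_itv `[0, r]) int1 intg).
  by rewrite Rintegral_one_itv.
rewrite -/g even intB gE big_bool /= -expRD; congr expR.
by ring.
Qed.

End formula.

(** * The idle event as a limit of finite blocks of roads and vehicles *)

Lemma counting_eq0 (R : realType) (U : choiceType) (S : set U) :
  counting S = 0%E :> \bar R <-> S = set0.
Proof.
split=> [|->]; last first.
  by rewrite /counting asboolT ?finite_set0// fset_set0.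
rewrite /counting; case: asboolP => // fS [] /eqP; rewrite pnatr_eq0 => /nilP S0.
apply/seteqP; split => // x Sx.
have : x \in finmap.enum_fset (fset_set S) by rewrite in_fset_set// mem_set.
by rewrite S0.
Qed.

Lemma cvg_bigcap_fin (R : realType) d (T : measurableType d) (P : probability T R)
    (F : nat -> set T) : (forall n, measurable (F n)) ->
  (forall m n, (m <= n)%N -> F n `<=` F m) ->
  P (F n) @[n --> \oo] --> P (\bigcap_n F n).
Proof.
move=> mF dF; apply: nonincreasing_cvg_mu => //.
- by rewrite (le_lt_trans (probability_le1 P (mF 0%N)))// ltry.
- exact: bigcapT_measurable.
- by move=> m n mn; apply/subsetPset; exact: dF.
Qed.

Section idle_probability.
Context {R : realType} {d : measure_display} {T : measurableType d}.
Variables (P : probability T R) (lambda_l lambda H a b r_s : R).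
Variables (road : road_index -> {RV P >-> R}) (vehicle : road_index -> nat -> {RV P >-> R}).
Variable detectable : vehicle_index -> {RV P >-> bool}.
Hypotheses (lambda0 : 0 < lambda) (H0 : 0 < H) (a0 : 0 < a).
Hypothesis r0 : 0 < r_s.
Hypothesis roads : manhattan_PLP road lambda_l.
Hypothesis vehicles : vehicles_on_roads road vehicle lambda.
Hypothesis LoS : LoS_detection road vehicle detectable (fun r => p_L a b r H).

Let D : set R := `[- r_s, r_s]%classic.
Let h := detection_prob a b H r_s.
Let g rho := laplace lambda D (h rho).
Let missed (v : vehicle_index) : set T :=
  ~` [set w | detectable v w /\ horizontal_distance road vehicle v w <= r_s].
Let road_of K (j : bool * 'I_K) : road_index := (j.1, j.2 : nat).

Let inj_road_of K : injective (@road_of K).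
Proof. by move=> [c1 i1] [c2 i2] [-> /val_inj ->]. Qed.

Let mD : measurable D. Proof. exact: measurable_itv. Qed.
Let bD : bounded_set D. Proof. exact: bounded_set_itvcc. Qed.
Let h01 rho x : 0 <= h rho x <= 1.
Proof. exact: detection_prob_itv01. Qed.
Let h_supp rho x : ~ D x -> h rho x = 0.
Proof. exact: detection_prob0r. Qed.
Let mh rho : measurable_fun setT (h rho).
Proof. by apply: (measurable_detection_prob b r_s a0 H0 (Y := cst rho) (X := id)). Qed.
Let g01 rho : 0 <= g rho <= 1.
Proof. by apply: laplace_itv01; [exact: ltW|move=> x; have /andP[] := h01 rho x]. Qed.

Let mg : measurable_fun setT g.
Proof.
exact: (measurable_laplace lambda mD bD mh h01 (@measurable_round_index _ r_s)
  (fun rho x => @cvg_detection_prob_round _ a b H r_s a0 H0 rho x)).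
Qed.

Let mixture K :
  (\int[P]_w (\prod_(j : bool * 'I_K)
     iprod (fun k => 1 - h (road (road_of j) w) (vehicle (road_of j) k w)))%:E =
   \int[P]_w (\prod_(j : bool * 'I_K) g (road (road_of j) w))%:E)%E.
Proof.
exact: (integral_iprod_mixture
  (fun C mC => poisson_on_vehicles vehicles (@inj_road_of K) mC)
  mD bD (ltW lambda0) mh h01 h_supp (@measurable_round_index _ r_s)
  (fun rho x => @cvg_detection_prob_round _ a b H r_s a0 H0 rho x)).
Qed.

Let factorE v w : 1 - (if horizontal_distance road vehicle v w <= r_s
    then p_L a b (horizontal_distance road vehicle v w) H else 0) =
  1 - h (road v.1 w) (vehicle v.1 v.2 w).
Proof.
case: v => [[c i] k]; congr (1 - _).
by rewrite /horizontal_distance; case: c => //=; rewrite addrC.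
Qed.

Let mmissed v : measurable (missed v).
Proof. exact: measurable_undetected. Qed.

Let prob_missed_fin K K' :
  (P (\bigcap_(j : bool * 'I_K) \bigcap_(k : 'I_K') missed (road_of j, k : nat)) =
   \int[P]_w (\prod_(j : bool * 'I_K)
     \prod_(k < K') (1 - h (road (road_of j) w) (vehicle (road_of j) k w)))%:E)%E.
Proof.
pose e (p : (bool * 'I_K) * 'I_K') : vehicle_index := (road_of p.1, p.2 : nat).
have inj_e : injective e.
  by move=> [[c1 i1] k1] [[c2 i2] k2] [-> /val_inj -> /val_inj ->].
have := prob_no_detectable r_s LoS (fun s => p_L_itv01 b H a0 s) inj_e.
rewrite (_ : \bigcap_j _ = \bigcap_(j : bool * 'I_K) \bigcap_(k : 'I_K') missed (road_of j, k : nat)).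
  move=> ->; apply: eq_integral => w _; congr EFin.
  by rewrite pair_bigA/=; apply: eq_bigr => -[j k] _; rewrite factorE.
by apply/seteqP; split => w wE; [move=> j _ k _; exact: (wE (j, k))|move=> [j k] _; exact: wE].
Qed.

(** The number of vehicles tends to infinity while [K] roads per direction are kept: [mixture] needs
    all vehicles on finitely many roads. Continuity from above handles the probabilities, bounded
    convergence the integrals. *)
Let prob_missed K :
  (P (\bigcap_k' \bigcap_(j : bool * 'I_K) \bigcap_(k : 'I_k') missed (road_of j, k : nat)) =
   \int[P]_w (\prod_(j : bool * 'I_K) g (road (road_of j) w))%:E)%E.
Proof.
rewrite -mixture.
have lhs := cvg_bigcap_fin (P := P)
  (F := fun K' => \bigcap_(j : bool * 'I_K) \bigcap_(k : 'I_K') missed (road_of j, k : nat)).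
apply: cvg_unique (lhs _ _) _ => //.
- move=> K'; apply: fin_bigcap_measurable => // j _.
  by apply: fin_bigcap_measurable => // k _; exact: mmissed.
- move=> m n mn w wn j _ k _.
  exact: (wn j I (widen_ord mn k) I).
rewrite (funext (prob_missed_fin K)).
have PTlty : (P setT < +oo)%E by rewrite probability_setT ltry.
have mfactor (j : bool * 'I_K) k : measurable_fun setT
    (fun w => 1 - h (road (road_of j) w) (vehicle (road_of j) k w)).
  by apply: measurable_funB => //; exact: measurable_detection_prob.
apply: bounded_convergence => //.
- by move=> n; apply: measurable_prod => j _; apply: measurable_prod => k _.
- apply: measurable_prod => j _; apply: measurable_iprod => // k w; exact: onem_itv01.
- apply: aeW => w _; apply: cvg_bigprod => j; apply: cvg_iprod => k; exact: onem_itv01.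
- move=> n w _; apply: prod_itv01 => j; apply: prod_itv01 => k; exact: onem_itv01.
Qed.

(** The Laplace functional is applied to the two road processes with the function [1 - g]. *)
Let roads_product :
  (\int[P]_w (\prod_(c : bool) iprod (fun i => g (road (c, i) w)))%:E =
   (\prod_(c : bool) expR (- (lambda_l * \int[lebesgue_measure]_(x in D) (1 - g x))))%:E)%E.
Proof.
have := integral_iprod measurableT (poisson_on_roads roads) mD bD
  (h := fun _ => fun rho => 1 - g rho).
rewrite probability_setT mul1e => <- //.
- apply: eq_integral => w _; congr EFin; apply: eq_bigr => c _; congr iprod.
  by apply/funext => i; rewrite opprB addrC subrK.
- by move=> _; exact: measurable_funB.
- by move=> _ x; exact: onem_itv01.
(* A road farther than [r_s] from the origin misses the disk, so [h x] vanishes and [g x = 1]; hence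
   [1 - g] is supported in [D]. *)
- move=> _ x Dx; rewrite /g (_ : h x = cst 0); last first.
    apply/funext => y; apply: detection_prob0l; rewrite ltNge; apply/negP => xr.
    by apply: Dx; rewrite /D/= in_itv/= -ler_norml.
  by rewrite /laplace Rintegral_cst// mul0r mulr0 oppr0 expR0 subrr.
Qed.

(** The idle event is the decreasing intersection of the events [F K] about the first [K] roads of
    each direction. As [K] grows, the finite products of [g] tend to the infinite products of
    [roads_product]. *)
Lemma prob_idle :
  P [set w | num_detectable road vehicle detectable r_s w = 0%E] =
  (expR (4 * lambda_l *
     (\int[lebesgue_measure]_(rho in `[0, r_s])
        expR (- Lambda lambda a b H r_s rho) - r_s)))%:E.
Proof.
pose F K := \bigcap_k' \bigcap_(j : bool * 'I_K) \bigcap_(k : 'I_k')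
  missed (road_of j, k : nat).
have -> : [set w | num_detectable road vehicle detectable r_s w = 0%E] = \bigcap_K F K.
  apply/seteqP; split => w.
    move=> /counting_eq0 w0 K _ K' _ j _ k _ vis.
    by have : set0 (road_of j, k : nat) by rewrite -w0.
  move=> wF; apply/counting_eq0/seteqP; split => // -[[c i] k] vis.
  (* Vehicle [k] of road [i] is the last one in the block of [i.+1] roads and [k.+1] vehicles. *)
  exact: (wF i.+1 I k.+1 I (c, ord_max) I ord_max I vis).
rewrite -(idle_exponent a0 H0 r0 lambda_l mg (ltW lambda0)) -roads_product.
have mF K : measurable (F K).
  apply: bigcapT_measurable => K'; apply: fin_bigcap_measurable => // j _.
  by apply: fin_bigcap_measurable => // k _; exact: mmissed.
have dF m n : (m <= n)%N -> F n `<=` F m.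
  by move=> mn w wn K' _ [c i] _ k _; exact: (wn K' I (c, widen_ord mn i) I k I).
apply: cvg_unique (cvg_bigcap_fin (P := P) mF dF) _ => //.
rewrite (funext prob_missed).
have PTlty : (P setT < +oo)%E by rewrite probability_setT ltry.
have mgroad c i : measurable_fun setT (fun w => g (road (c, i) w)).
  exact: measurableT_comp.
apply: bounded_convergence => //.
- by move=> n; apply: measurable_prod => -[c i] _; exact: (mgroad c i).
- apply: measurable_prod => c _.
  apply: (measurable_iprod (f := fun i w => g (road (c, i) w))) => [i|i w].
    exact: (mgroad c i).
  exact: g01.
- apply: aeW => w _.
  have pairE n : \prod_(j : bool * 'I_n) g (road (road_of j) w) =
      \prod_(c : bool) \prod_(i < n) g (road (c, i : nat) w).
    by rewrite pair_bigA.
  rewrite (funext pairE); apply: cvg_bigprod => c.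
  by apply: (cvg_iprod (f := fun i => g (road (c, i) w))) => i; exact: g01.
- by move=> n w _; apply: prod_itv01 => j; exact: g01.
Qed.

End idle_probability.

Theorem corollary3p6 (R : realType) (d : measure_display)
    (T : measurableType d) (P : probability T R)
    (lambda_l lambda H a b r_s : R)
    (road : road_index -> {RV P >-> R})
    (vehicle : road_index -> nat -> {RV P >-> R})
    (detectable : vehicle_index -> {RV P >-> bool}) :
  0 < lambda_l -> 0 < lambda -> 0 < H -> 0 < a -> 0 < b -> 0 < r_s ->
  manhattan_PLP road lambda_l ->
  vehicles_on_roads road vehicle lambda ->
  LoS_detection road vehicle detectable (fun r => p_L a b r H) ->
  P [set w | num_detectable road vehicle detectable r_s w = 0%E] =
  (expR (4 * lambda_l *
     (\int[lebesgue_measure]_(rho in `[0, r_s])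
        expR (- Lambda lambda a b H r_s rho) - r_s)))%:E.
Proof.
move=> _ lambda0 H0 a0 _ r0 roads vehicles LoS.
exact: (prob_idle lambda0 H0 a0 r0 roads vehicles LoS).
Qed.
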